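(* Let $\rho\in[0,1]$ and $a\in\mathbb R$. Let $F_{at}(t)[\eta^\rho,\omega]$ be the flux, up to time $t$, of particles of the tasep with initial configuration $\eta^\rho$ along the trajectory $y_t=at$. Then $$\lim_{t\to\infty}\frac{F_{at}(t)[\eta^\rho,\omega]}{t}=\rho\,[(1-\rho)-a]\qquad\text{almost surely.}$$
   Context: Configurations are elements $\eta\in\{0,1\}^{\mathbb Z}$; $\eta(x)=1$ means there is a particle at site $x$, and $\eta(x)=0$ a hole. Tasep (graphical construction): let $\omega$ be a rate-1 Poisson process on $\mathbb Z\times\mathbb R^+$ (for each $x$, the times $t$ with $(x,t)\in\omega$ form a rate-1 Poisson process, independently over $x$). If $(x,t)\in\omega$ there is an arrow $x\to x+1$ at time $t$. Given an initial configuration $\eta$, at each arrow $(x,t)$, if just before $t$ there is a particle at $x$ and a hole at $x+1$, the particle jumps to $x+1$; otherwise nothing changes. For almost every $\omega$, for each $T>0$ the line splits into finite boxes with no arrows between boxes during $(0,T)$, so this defines a configuration $\eta_t[\eta,\omega]$ and the trajectory of every individual particle for all $t\ge0$. Let $U=(U(x))_{x\in\mathbb Z}$ be i.i.d. uniform on $[0,1]$, independent of $\omega$, and $\eta^\rho(x)=\mathbf 1\{U(x)<\rho\}$ (a Bernoulli($\rho$) product configuration). Almost surely refers to the joint law of $(U,\omega)$. Flux: label the particles of $\eta$ in increasing order of initial position by $i\in\mathbb Z$, so that particle $0$ is the rightmost particle initially at a site $\le0$ (particles with $i\le0$ start at sites $\le0$, those with $i>0$ start at sites $>0$). Let $X_t(i)$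 be the position of particle $i$ at time $t$. For a trajectory $(y_t)_{t\ge0}$ in $\mathbb R$ with $y_0=0$, the flux along $y_t$ is $$F_{y_t}(t)[\eta,\omega]=\sum_{i\le0}\mathbf 1\{X_t(i)>y_t\}-\sum_{i>0}\mathbf 1\{X_t(i)\le y_t\},$$ where sums run over existing particles (so the flux is $0$ if there are no particles). *)

(* Defs.v *)
From HB Require Import structures.
From mathcomp Require Import all_boot all_order all_algebra finmap.
From mathcomp Require Import all_classical all_reals all_analysis measurable_realfun.
Set Implicit Arguments.
Unset Strict Implicit.
Unset Printing Implicit Defensive.
Import Order.TTheory GRing.Theory Num.Theory.
Import numFieldNormedType.Exports.
Local Open Scope classical_set_scope.
Local Open Scope ring_scope.

Definition config := int -> bool.

Section dynamics.
Context {R : realType}.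

(* The point (x, t) is an arrow x -> x+1 at time t. *)
Implicit Types (W : set (int * R)) (eta : config) (x z l r i : int) (t : R).

(* A configuration, together with the current position of the particle that
   started at each site; the value at initially empty sites is meaningless. *)
Definition state := (config * (int -> int))%type.

Definition fire (S : state) x : state :=
  if S.1 x && ~~ S.1 (x + 1) then
    (fun y => if y == x then false else if y == x + 1 then true else S.1 y,
     fun z => if S.2 z == x then x + 1 else S.2 z)
  else S.

Definition quiet W t x := forall s : R, 0 < s <= t -> ~ W (x, s).

(* The sites l+1, ..., r contain z and no arrow enters or leaves them up to
   time t. *)
Definition is_box W t z (b : int * int) :=
  [/\ b.1 < z <= b.2, quiet W t b.1 & quiet W t b.2].

Definition box_arrows W t (b : int * int) : set (int * R) :=
  [set p | [/\ W p, b.1 < p.1 < b.2 & 0 < p.2 <= t]].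

(* The arrows in the box are fired in the order of their times. Almost surely
   there are finitely many of them, at distinct times; fset_set is empty on
   infinite sets. *)
Definition box_evolve W t eta (b : int * int) : state :=
  foldl fire (eta, id)
    [seq p.1 | p <- sort (fun p q => p.2 <= q.2) (fset_set (box_arrows W t b))].

(* Any box gives the same result almost surely, and boxes exist almost surely. *)
Definition box_of W t z : int * int := xget (z, z) [set b | is_box W t z b].

(* Position at time t of the particle that starts at z. *)
Definition tasep_position W eta t z : int :=
  (box_evolve W t eta (box_of W t z)).2 z.

(* Label of a particle starting at x: minus the number of particles in (x, 0]
   if x <= 0, the number of particles in (0, x] if x > 0. *)
Definition label eta x : int :=
  if x <= 0 then - (count (fun k : nat => eta (- k%:Z)) (iota 0 `|x|%N))%:Z
  else (count (fun k : nat => eta k%:Z) (iota 1 `|x|%N))%:Z.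

Definition particle eta i := exists2 x, eta x & label eta x = i.

Definition start eta i : int := xget 0 [set x | eta x /\ label eta x = i].

Definition particle_position W eta t i : int := tasep_position W eta t (start eta i).

Definition initially_left eta : set int := [set i | i <= 0 /\ particle eta i].

Definition initially_right eta : set int := [set i | 0 < i /\ particle eta i].

(* Extended-real-valued because the sums may be infinite for an arbitrary W. *)
Definition flux W eta (y : R -> R) t : \bar R :=
  (\esum_(i in initially_left eta)
      ((y t < (particle_position W eta t i)%:~R)%R%:R)%:E
   - \esum_(i in initially_right eta)
      (((particle_position W eta t i)%:~R <= y t)%R%:R)%:E)%E.

End dynamics.

Section probability.
Context {R : realType} {d : measure_display} {T : measurableType d}.
Variable P : probability T R.

Definition mutually_independent (I : choiceType) (G : I -> set (set T)) :=
  forall (J : {fset I}) (A : I -> set T),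
    (forall i, i \in J -> G i (A i)) ->
    P (\bigcap_(i in [set` J]) A i) = (\prod_(i <- J) P (A i))%E.

Definition sigma_join (I : Type) (G : I -> set (set T)) : set (set T) :=
  <<s \bigcup_(i in setT) G i >>.

Definition iid_uniform (U : int -> {RV P >-> R}) :=
  (forall x (A : set R), measurable A ->
     distribution P (U x) A = uniform_prob (@ltr01 R) A) /\
  mutually_independent (fun x => g_sigma_algebra_preimage (U x)).

Definition bernoulli_config (U : int -> {RV P >-> R}) (rho : R) (w : T) :
  config := fun x => U x w < rho.

Variable omega : T -> set (int * R).

Definition arrow_count (x : int) (s t : R) (w : T) : \bar R :=
  counting [set u : R | omega w (x, u) /\ s < u <= t].

Definition sigma_arrows (x : int) : set (set T) :=
  sigma_join (fun st : {st : R * R | 0 <= st.1 <= st.2} =>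
    g_sigma_algebra_preimage (arrow_count x (val st).1 (val st).2)).

(* poisson_law excludes s = t because poisson_pmf is constantly 1 at rate 0. *)
Record poisson_process : Prop := {
  poisson_support : forall w x u, omega w (x, u) -> 0 <= u ;
  poisson_measurable : forall x (s t : R), 0 <= s <= t ->
    measurable_fun setT (arrow_count x s t) ;
  poisson_law : forall x (s t : R) (n : nat), 0 <= s < t ->
    P [set w | arrow_count x s t w = n%:R%:E] = (poisson_pmf (t - s) n)%:E ;
  poisson_increments : forall x (s : nat -> R), 0 <= s 0%N ->
    (forall k, s k <= s k.+1) ->
    mutually_independent (fun k => g_sigma_algebra_preimage (arrow_count x (s k) (s k.+1))) ;
  poisson_sites : mutually_independent sigma_arrows }.

Definition independent_inputs (U : int -> {RV P >-> R}) :=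
  forall A B, sigma_join (fun x => g_sigma_algebra_preimage (U x)) A ->
    sigma_join sigma_arrows B -> P (A `&` B) = (P A * P B)%E.

End probability.

(* Main.v *)
(* The product Bernoulli measure is invariant for the tasep on a ring, since a
   ring has as many particle-hole pairs as hole-particle pairs. On a ring, the
   current through a bond up to time t differs by at most L from its average
   over L consecutive bonds, and that average is a martingale plus the time
   integral of the spatial density of particle-hole pairs. By stationarity the
   density concentrates around rho (1 - rho), so the second moment of the
   deviation of the averaged current is O(t^2 / L).
   Time is cut into n slots of length t/n. Outside an event of vanishing
   probability each slot contains at most one arrow of a large finite window, so
   that the continuous-time dynamics is a function of independent Bernoulli
   variables, and the window contains quiet sites on both sides of the origin,
   between which the dynamics on the line and on the ring agree. The flux along y
   is the current through the bond at y minus the initial number of particles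
   between 0 and y. Along t = k^3 with L = k^2 the error probabilities are
   summable, and the monotonicity of the flux in time and in the barrier gives
   the limit along all real t. *)
Require Import Defs.
From HB Require Import structures.
From mathcomp Require Import all_boot all_order all_algebra finmap perm.
From mathcomp Require Import all_classical all_reals all_analysis measurable_realfun.
From mathcomp Require Import ring lra zify.
Set Implicit Arguments.
Unset Strict Implicit.
Unset Printing Implicit Defensive.
Import Order.TTheory GRing.Theory Num.Theory.
Import numFieldNormedType.Exports.
Local Open Scope classical_set_scope.
Local Open Scope ring_scope.

(** A site stays quiet up to time t with probability exp(-t) only, so the window that provides quiet
    sites is exponentially long in t. Hence no moment bound may grow with the length of the ring:
    the current is averaged over just L bonds next to y, and the bounds involve L alone. These L
    bonds may leave the region where line and ring agree, because they are compared with the bond at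
    y on the ring. The slot length is chosen last, once the window is fixed, so that two arrows in
    one slot become unlikely even in such a window. For a deviation of order L + eps t, the
    probability of error is of order 1 / (L eps^2) + |y| / (eps t)^2. Three requirements meet: L =
    o(t), summability of 1 / L along the chosen times, and consecutive times with ratio tending to
    1. The scales t = k^3 and L = k^2 satisfy all of them. *)

(** * Tasep on a finite ring *)

Section ring_dynamics.
Context {I : finType} (nx : I -> I).
Implicit Types (e : {ffun I -> bool}) (x : I) (o : option I) (s : seq (option I)).

Definition active e x := e x && ~~ e (nx x).

(** Written with a transposition because exchanging two sites preserves the product measure; see
    [Ebern_hop]. *)
Definition hop e x : {ffun I -> bool} :=
  if active e x then [ffun y => e (tperm x (nx x) y)] else e.

Definition step e o := if o is Some x then hop e x else e.

Definition moves e o x := (o == Some x) && active e x.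

Fixpoint current e s x : nat :=
  if s is o :: s' then moves e o x + current (step e o) s' x else 0.

(** Particle balance at [nx x], inflow against outflow, in additive form to avoid subtraction in
    [nat]. *)
Lemma hop_nx (nx_inj : injective nx) (nx_neq : forall x, nx x != x) e o x :
  (step e o (nx x) + moves e o (nx x) = e (nx x) + moves e o x)%N.
Proof.
case: o => [z|] /=; rewrite /moves /= ?addn0 //.
have [->|zx] := eqVneq z x.
  rewrite eqxx (negbTE (_ : Some x != Some (nx x))) ?addn0; last first.
    by apply: contra (nx_neq x) => /eqP[xE]; rewrite -xE.
  rewrite /hop; case: ifPn => [act|]; last by rewrite addn0.
  by rewrite ffunE tpermR; move: act; rewrite /active => /andP[-> /negbTE ->].
rewrite (negbTE (_ : Some z != Some x)) ?addn0; last first.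
  by apply: contra zx => /eqP[->].
rewrite /hop; case: (eqVneq (Some z) (Some (nx x))) => [[->]|zn] /=.
  case: ifPn => [act|]; last by rewrite addn0.
  rewrite ffunE tpermL; move: act; rewrite /active => /andP[-> /negbTE ->] //.
rewrite addn0; case: ifPn => // act.
by rewrite ffunE tpermD // (inj_eq nx_inj).
Qed.

Lemma current_nx (nx_inj : injective nx) (nx_neq : forall x, nx x != x) e s x :
  (foldl step e s (nx x) + current e s (nx x) = e (nx x) + current e s x)%N.
Proof.
elim: s e => [|o s IH] e /=; first by rewrite !addn0.
by move: (hop_nx nx_inj nx_neq e o x) (IH (step e o)); lia.
Qed.

(** Occupation numbers are 0 or 1, so [current_nx] lets the current change by at most one per
    bond. *)
Lemma current_iter (nx_inj : injective nx) (nx_neq : forall x, nx x != x) e s x j :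
  (current e s x <= current e s (iter j nx x) + j)%N /\
  (current e s (iter j nx x) <= current e s x + j)%N.
Proof.
elim: j => [|j [h1 h2]] /=; first by rewrite addn0.
by have := current_nx nx_inj nx_neq e s (iter j nx x); lia.
Qed.

End ring_dynamics.

(** * Expectation over words of independent letters *)

Section word_expectation.
Context {R : realFieldType} {I A : finType}.
Context (w : A -> R) (dec : A -> option I).
Context (w_ge0 : forall a, 0 <= w a) (w_sum1 : \sum_a w a = 1).
Implicit Types (f g : seq (option I) -> R).

(** The recursion exposes the first letter, which suits inductions along the path; [Ew_tuple]
    recovers the sum over all words that is compared with probabilities. *)
Fixpoint Ew n f : R :=
  if n is n'.+1 then \sum_a w a * Ew n' (fun s => f (dec a :: s)) else f [::].

Lemma eq_Ew n f g : (forall s, size s = n -> f s = g s) -> Ew n f = Ew n g.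
Proof.
elim: n f g => [|n IH] f g fg /=; first exact: fg.
by apply: eq_bigr => a _; congr (_ * _); apply: IH => s sn; rewrite fg //= sn.
Qed.

Lemma EwD n f g : Ew n (fun s => f s + g s) = Ew n f + Ew n g.
Proof.
elim: n f g => [|n IH] f g //=.
by rewrite -big_split; apply: eq_bigr => a _; rewrite IH mulrDr.
Qed.

Lemma EwZ n c f : Ew n (fun s => c * f s) = c * Ew n f.
Proof.
elim: n f => [|n IH] f //=.
by rewrite mulr_sumr; apply: eq_bigr => a _; rewrite IH mulrCA.
Qed.

Lemma Ew_cst n c : Ew n (fun=> c) = c.
Proof.
elim: n => [|n IH] //=.
by under eq_bigr do rewrite IH; rewrite -mulr_suml w_sum1 mul1r.
Qed.

Lemma le_Ew n f g : (forall s, size s = n -> f s <= g s) -> Ew n f <= Ew n g.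
Proof.
elim: n f g => [|n IH] f g fg /=; first exact: fg.
apply: ler_sum => a _; apply: ler_wpM2l => //.
by apply: IH => s sn; rewrite fg //= sn.
Qed.

Lemma Ew_tuple n f :
  Ew n f = \sum_(s : n.-tuple A) (\prod_(a <- s) w a) * f (map dec s).
Proof.
elim: n f => [|n IH] f /=.
  rewrite (big_pred1 [tuple]) ?big_nil ?mul1r// => s.
  by rewrite /= (_ : s = [tuple]) ?eqxx //; apply: val_inj; case: s => -[].
under eq_bigr do rewrite IH.
rewrite (reindex (fun p : A * n.-tuple A => cons_tuple p.1 p.2)) /=; last first.
  exists (fun s => (thead s, behead_tuple s)).
    by move=> [a s] _ /=; congr pair; apply: val_inj.
  by move=> s _; apply: val_inj; case: s => -[].
rewrite -(pair_bigA _ (fun (a : A) (s : n.-tuple A) =>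
  (\prod_(b <- a :: s) w b) * f (dec a :: map dec s))) /=.
apply: eq_bigr => a _; rewrite mulr_sumr; apply: eq_bigr => s _.
by rewrite big_cons mulrA.
Qed.

End word_expectation.

(** * The product Bernoulli measure *)

Section bernoulli.
Context {R : realFieldType} {I : finType} (r : R).
Context (r01 : 0 <= r <= 1).
Implicit Types (e : {ffun I -> bool}) (x y : I).

Definition bern (b : bool) : R := if b then r else 1 - r.

Definition bern_prod e : R := \prod_x bern (e x).

Definition Ebern (f : {ffun I -> bool} -> R) : R := \sum_e bern_prod e * f e.

Lemma bern_ge0 b : 0 <= bern b.
Proof. by case/andP: r01 => r0 r1; rewrite /bern; case: b; lra. Qed.

Lemma bern_prod_ge0 e : 0 <= bern_prod e.
Proof. by apply: prodr_ge0 => x _; apply: bern_ge0. Qed.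

Lemma Ebern_prod (phi : I -> bool -> R) :
  Ebern (fun e => \prod_x phi x (e x)) = \prod_x (r * phi x true + (1 - r) * phi x false).
Proof.
rewrite /Ebern /bern_prod /=.
under eq_bigr do rewrite -big_split /=.
rewrite -(bigA_distr_bigA (fun x b => bern b * phi x b)) /=.
by apply: eq_bigr => x _; rewrite big_bool.
Qed.

Lemma EbernD f g : Ebern (fun e => f e + g e) = Ebern f + Ebern g.
Proof. by rewrite -big_split; apply: eq_bigr => e _; rewrite mulrDr. Qed.

Lemma EbernZ c f : Ebern (fun e => c * f e) = c * Ebern f.
Proof. by rewrite mulr_sumr; apply: eq_bigr => e _; rewrite mulrCA. Qed.

Lemma Ebern_sum (J : Type) (l : seq J) (F : J -> {ffun I -> bool} -> R) :
  Ebern (fun e => \sum_(j <- l) F j e) = \sum_(j <- l) Ebern (F j).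
Proof.
rewrite /Ebern exchange_big; apply: eq_bigr => e _; by rewrite mulr_sumr.
Qed.

Lemma eq_Ebern f g : f =1 g -> Ebern f = Ebern g.
Proof. by move=> fg; apply: eq_bigr => e _; rewrite fg. Qed.

Lemma le_Ebern f g : (forall e, f e <= g e) -> Ebern f <= Ebern g.
Proof.
by move=> fg; apply: ler_sum => e _; apply: ler_wpM2l => //; apply: bern_prod_ge0.
Qed.

Lemma bern_prod_sum1 : \sum_e bern_prod e = 1.
Proof.
have <- : Ebern (fun e => \prod_(x : I) 1) = \sum_e bern_prod e.
  by apply: eq_bigr => e _; rewrite big1 ?mulr1.
by rewrite (Ebern_prod (fun _ _ => 1)) big1 // => x _; rewrite !mulr1 addrC subrK.
Qed.

Lemma Ebern_cst c : Ebern (fun=> c) = c.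
Proof. by rewrite /Ebern -mulr_suml bern_prod_sum1 mul1r. Qed.

(** Independence of functions of disjoint sets of sites: the hypothesis says that no site influences
    both products. *)
Lemma Ebern_prodM (phi psi : I -> bool -> R) :
  (forall x, phi x = (fun=> 1) \/ psi x = (fun=> 1)) ->
  Ebern (fun e => (\prod_x phi x (e x)) * (\prod_x psi x (e x))) =
  Ebern (fun e => \prod_x phi x (e x)) * Ebern (fun e => \prod_x psi x (e x)).
Proof.
move=> disj.
rewrite (eq_Ebern (g := fun e => \prod_x (phi x (e x) * psi x (e x)))); last first.
  by move=> e; rewrite big_split.
rewrite (Ebern_prod (fun x b => phi x b * psi x b)) !Ebern_prod -big_split /=.
by apply: eq_bigr => x _; case: (disj x) => -> /=; ring.
Qed.

(** In the expanded square, centred pairs that are not [near] have mean 0 and every other pair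
    contributes at most 1. *)
Lemma Ebern_sum_sqr (l : seq I) (F : I -> {ffun I -> bool} -> R) (m : R)
    (near : rel I) (D : nat) :
  (forall x, Ebern (F x) = m) -> (forall x e, 0 <= F x e <= 1) ->
  (forall x y, ~~ near x y -> Ebern (fun e => F x e * F y e) = m * m) ->
  (forall x, (count (near x) l <= D)%N) ->
  Ebern (fun e => (\sum_(x <- l) F x e - (size l)%:R * m) ^+ 2) <=
    (D * size l)%:R.
Proof.
move=> EF F01 unc nearD.
(* The bounds on [m] come from the mean at some site, so the empty list is treated apart. *)
case: l nearD => [_|x0 l' nearD].
  rewrite muln0 (eq_Ebern (g := fun=> 0)) ?Ebern_cst // => e.
  by rewrite big_nil mul0r subrr expr0n.
have m01 : 0 <= m <= 1.
  rewrite -(EF x0) -{1}(Ebern_cst 0) -(Ebern_cst 1).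
  by apply/andP; split; apply: le_Ebern => e; case/andP: (F01 x0 e).
move: (x0 :: l') nearD => {x0 l'} l nearD.
pose G x e := F x e - m.
have G1 x y e : G x e * G y e <= 1.
  by rewrite /G; move: (F01 x e) (F01 y e) m01; nra.
rewrite (eq_Ebern (g := fun e => \sum_(x <- l) \sum_(y <- l) G x e * G y e)); last first.
  move=> e; rewrite expr2.
  have -> : \sum_(x <- l) F x e - (size l)%:R * m = \sum_(x <- l) G x e.
    by rewrite /G big_split /= big_const_seq count_predT iter_addr_0 mulNrn mulr_natl.
  by rewrite big_distrl; apply: eq_bigr => x _; rewrite big_distrr.
rewrite Ebern_sum.
have -> : (D * size l)%:R = \sum_(x <- l) D%:R :> R.
  by rewrite big_const_seq count_predT iter_addr_0 natrM mulr_natr.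
apply: ler_sum => x _; rewrite Ebern_sum.
apply: (@le_trans _ _ (\sum_(y <- l) (near x y)%:R)); last first.
  rewrite -natr_sum ler_nat (leq_trans _ (nearD x)) // -sum1_count [leqRHS]big_mkcond.
  by apply: leq_sum => y _; case: (near x y).
apply: ler_sum => y _; case: (boolP (near x y)) => [xy|/unc xy].
  by rewrite -(Ebern_cst 1); apply: le_Ebern.
have GE e : G x e * G y e = F x e * F y e + (- m) * F x e + (- m) * F y e + m * m.
  by rewrite /G; ring.
rewrite (eq_Ebern GE) !EbernD !EbernZ Ebern_cst !EF xy /=.
rewrite le_eqVlt; apply/orP; left; apply/eqP; ring.
Qed.

End bernoulli.

(** * Invariance of the Bernoulli measure and its density fluctuations *)

Section ring_stationarity.
Context {R : realFieldType} {I A : finType}.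
Context (r : R) (r01 : 0 <= r <= 1).
Context (nx : I -> I) (nx_inj : injective nx) (nx_neq : forall x, nx x != x).
Context (w : A -> R) (dec : A -> option I) (q : R).
Context (w_ge0 : forall a, 0 <= w a) (w_sum1 : \sum_a w a = 1).
Context (w_hop : forall x, \sum_(a | dec a == Some x) w a = q).
Implicit Types (e : {ffun I -> bool}) (x y : I).

Local Notation Eb := (Ebern r).
Local Notation Ew := (Ew w dec).

(** One step of the chain is the identity plus [q] times the generator of the tasep. *)
Lemma mean_step (g : {ffun I -> bool} -> R) e :
  \sum_a w a * g (step nx e (dec a)) = g e + q * \sum_x (g (hop nx e x) - g e).
Proof.
have -> : g e = \sum_a w a * g e by rewrite -mulr_suml w_sum1 mul1r.
apply/eqP; rewrite addrC -subr_eq -sumrB; apply/eqP.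
under eq_bigr do rewrite -mulrBr.
have -> : \sum_a w a * g e = g e by rewrite -mulr_suml w_sum1 mul1r.
transitivity (\sum_a \sum_x
    (if dec a == Some x then w a * (g (hop nx e x) - g e) else 0)).
  apply: eq_bigr => a _; rewrite -big_mkcond /=; case: (dec a) => [x|] /=.
    by rewrite (big_pred1 x) // => y; rewrite /= eq_sym; apply: (inj_eq Some_inj).
  by rewrite big_pred0 // subrr mulr0.
rewrite exchange_big /= mulr_sumr; apply: eq_bigr => x _.
by rewrite -big_mkcond -mulr_suml w_hop.
Qed.

Definition swap x e : {ffun I -> bool} := [ffun y => e (tperm x (nx x) y)].

Lemma swapK x : involutive (swap x).
Proof. by move=> e; apply/ffunP => y; rewrite !ffunE tpermK. Qed.

Lemma bern_prod_swap x e : bern_prod r (swap x e) = bern_prod r e.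
Proof.
rewrite /bern_prod [RHS](reindex_inj (@perm_inj _ (tperm x (nx x)))).
by apply: eq_bigr => y _; rewrite ffunE.
Qed.

(** The exchange preserves the measure and turns a particle-hole pair into a hole-particle pair. The
    difference of the two indicators is [e (nx x) - e x], which telescopes around the ring. *)
Lemma Ebern_hop (g : {ffun I -> bool} -> R) x :
  Eb (fun e => g (hop nx e x) - g e) =
  Eb (fun e => g e * ((e (nx x))%:R - (e x)%:R)).
Proof.
transitivity (Eb (fun e => (active nx e x)%:R * g (swap x e)) +
              (-1) * Eb (fun e => (active nx e x)%:R * g e)).
  rewrite -EbernZ -EbernD; apply: eq_Ebern => e; rewrite /hop.
  by case: (active nx e x) => /=; rewrite -/(swap x e); ring.
rewrite {1}/Ebern (reindex_inj (inv_inj (swapK x))) /=.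
under eq_bigr do rewrite swapK bern_prod_swap.
rewrite -/(Ebern r (fun e => (active nx (swap x e) x)%:R * g e)).
rewrite -EbernZ -EbernD; apply: eq_Ebern => e.
rewrite /active /swap !ffunE tpermL tpermR.
by case: (e x); case: (e (nx x)) => /=; ring.
Qed.

(* On a ring there are as many particle-hole pairs as hole-particle pairs. *)
Lemma Ebern_stationary (g : {ffun I -> bool} -> R) :
  Eb (fun e => \sum_a w a * g (step nx e (dec a))) = Eb g.
Proof.
rewrite (eq_Ebern _ (mean_step g)) EbernD EbernZ Ebern_sum.
under eq_bigr do rewrite Ebern_hop.
rewrite -Ebern_sum [X in q * X](_ : _ = 0) ?mulr0 ?addr0 //.
rewrite -[RHS](@Ebern_cst R I r 0); apply: eq_Ebern => e.
rewrite -mulr_sumr sumrB [X in X - _](_ : _ = \sum_x (e x)%:R) ?subrr ?mulr0 //.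
by rewrite [RHS](reindex_inj nx_inj).
Qed.

Lemma Ebern_site x : Eb (fun e => (e x)%:R) = r.
Proof.
rewrite (eq_Ebern _ (g := fun e => \prod_z (if z == x then (e z)%:R else 1))); last first.
  by move=> e; rewrite -big_mkcond big_pred1_eq.
rewrite (Ebern_prod _ (fun z (b : bool) => if z == x then b%:R else 1)).
rewrite (bigD1 x) //= eqxx big1 ?mulr1 ?mulr0 ?addr0 // => z /negbTE ->.
by ring.
Qed.

Lemma Ebern_particles (l : seq I) : uniq l ->
  Eb (fun e => (\sum_(x <- l) (e x)%:R - (size l)%:R * r) ^+ 2) <= (size l)%:R.
Proof.
move=> l_uniq; rewrite -[size l in X in _ <= X]mul1n.
apply: (Ebern_sum_sqr r01 (near := eq_op)) => [x|x e|x y xy|x].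
- exact: Ebern_site.
- by case: (e x) => /=; lra.
- pose ph x z (b : bool) : R := if z == x then b%:R else 1.
  have phE x' e : (e x')%:R = \prod_z ph x' z (e z).
    by rewrite /ph -big_mkcond big_pred1_eq.
  have Eph x' : r = Eb (fun e => \prod_z ph x' z (e z)).
    by rewrite -(eq_Ebern _ (phE x')) Ebern_site.
  rewrite [X in X * _](Eph x) [X in _ * X](Eph y).
  rewrite -Ebern_prodM; first by apply: eq_Ebern => e; rewrite !phE.
  move=> z; rewrite /ph; have [->|_] := eqVneq z x; last by left.
  by rewrite (negbTE xy); right.
- by rewrite (@eq_count _ _ (pred1 x)) ?count_uniq_mem ?leq_b1 // => y; rewrite /= eq_sym.
Qed.

Lemma Ebern_active x : Eb (fun e => (active nx e x)%:R) = r * (1 - r).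
Proof.
rewrite (eq_Ebern _ (g := fun e => \prod_z
  (if z == x then (e z)%:R else if z == nx x then (~~ e z)%:R else 1))); last first.
  move=> e; rewrite (bigD1 x) //= (bigD1 (nx x)) /= ?nx_neq // eqxx.
  rewrite (negbTE (nx_neq x)) eqxx big1 ?mulr1 => [|z /andP[/negbTE -> /negbTE ->]] //.
  by rewrite /active; case: (e x); case: (e _); rewrite ?mulr0 ?mulr1.
rewrite (Ebern_prod _ (fun z (b : bool) =>
  if z == x then b%:R else if z == nx x then (~~ b)%:R else 1)).
rewrite (bigD1 x) //= (bigD1 (nx x)) /= ?nx_neq // eqxx (negbTE (nx_neq x)) eqxx.
rewrite big1 => [|z /andP[/negbTE -> /negbTE ->]] /=; ring.
Qed.

(** The bonds starting at [x] and [y] share a site only if [y] is [x], its successor or its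
    predecessor, hence the factor 3. *)
Lemma Ebern_actives (l : seq I) : uniq l ->
  Eb (fun e => (\sum_(x <- l) (active nx e x)%:R - (size l)%:R * (r * (1 - r))) ^+ 2)
    <= (3 * size l)%:R.
Proof.
move=> l_uniq.
apply: (Ebern_sum_sqr r01 (near := fun x y => [|| y == x, y == nx x | x == nx y]))
  => [x|x e|x y xy|x].
- exact: Ebern_active.
- by case: (active nx e x) => /=; lra.
- pose ph x z (b : bool) : R :=
    if z == x then b%:R else if z == nx x then (~~ b)%:R else 1.
  have phE x' e : (active nx e x')%:R = \prod_z ph x' z (e z).
    rewrite (bigD1 x') //= (bigD1 (nx x')) /= ?nx_neq // /ph eqxx.
    rewrite (negbTE (nx_neq x')) eqxx big1 ?mulr1 => [|z /andP[/negbTE -> /negbTE ->]] //.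
    by rewrite /active; case: (e x'); case: (e _); rewrite ?mulr0 ?mulr1.
  have Eph x' : r * (1 - r) = Eb (fun e => \prod_z ph x' z (e z)).
    by rewrite -(eq_Ebern _ (phE x')) Ebern_active.
  rewrite [X in X * _](Eph x) [X in _ * X](Eph y).
  rewrite -Ebern_prodM; first by apply: eq_Ebern => e; rewrite !phE.
  move=> z; rewrite /ph; move: xy; rewrite !negb_or => /and3P[yx ynx xny].
  have [->|zx] := eqVneq z x; first by right; rewrite eq_sym (negbTE yx) (negbTE xny).
  have [->|znx] := eqVneq z (nx x); last by left.
  by right; rewrite eq_sym (negbTE ynx) (inj_eq nx_inj) eq_sym (negbTE yx).
- rewrite (leq_trans (n := count (pred1 x) l + (count (pred1 (nx x)) l +
    count [pred y | x == nx y] l))) //.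
    by elim: {l_uniq} l => //= z l; lia.
  rewrite !count_uniq_mem // (leq_add (n1 := 1) (n2 := 2)) ?leq_b1 //.
  rewrite (leq_add (n1 := 1) (n2 := 1)) ?leq_b1 //.
  case: (boolP (x \in codom nx)) => [/codomP[y0 ->]|xn].
    rewrite (@eq_count _ _ (pred1 y0)) ?count_uniq_mem ?leq_b1 // => y.
    by rewrite /= (inj_eq nx_inj) eq_sym.
  rewrite (@eq_count _ _ pred0) ?count_pred0 // => y /=.
  by apply/negbTE; apply: contra xn => /eqP ->; apply: codom_f.
Qed.

End ring_stationarity.

(** * Second moment of the current on the ring *)

Section ring_current.
Context {R : realFieldType} {I A : finType}.
Context (r : R) (r01 : 0 <= r <= 1).
Context (nx : I -> I) (nx_inj : injective nx) (nx_neq : forall x, nx x != x).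
Context (w : A -> R) (dec : A -> option I) (q : R).
Context (w_ge0 : forall a, 0 <= w a) (w_sum1 : \sum_a w a = 1).
Context (w_hop : forall x, \sum_(a | dec a == Some x) w a = q).
Context (l : seq I) (l_uniq : uniq l).
Implicit Types (e : {ffun I -> bool}) (x y : I) (s : seq (option I)).

Local Notation Eb := (Ebern r).
Local Notation Ew := (Ew w dec).

Definition actives e : R := \sum_(x <- l) (active nx e x)%:R.

Definition mart_step e o : R := \sum_(x <- l) (moves nx e o x)%:R - q * actives e.

Fixpoint martingale e s : R :=
  if s is o :: s' then mart_step e o + martingale (step nx e o) s' else 0.

Fixpoint drift e s : R :=
  if s is o :: s' then
    q * (actives e - (size l)%:R * (r * (1 - r))) + drift (step nx e o) s'
  else 0.

(** Doob decomposition: compensated jumps, centred number of active bonds summed along the path, and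
    deterministic mean. *)
Lemma current_decomposition e s :
  \sum_(x <- l) (current nx e s x)%:R =
  martingale e s + drift e s + (size s)%:R * (q * (size l)%:R * (r * (1 - r))).
Proof.
elim: s e => [|o s IH] e /=; first by rewrite big1 // !add0r mul0r.
under eq_bigr do rewrite natrD.
by rewrite big_split /= IH /mart_step -natr1; ring.
Qed.

Lemma q_ge0 : I -> 0 <= q.
Proof. by move=> x; rewrite -(w_hop x) sumr_ge0. Qed.

Lemma mean_moves e x : \sum_a w a * (moves nx e (dec a) x)%:R = q * (active nx e x)%:R.
Proof.
rewrite -(w_hop x) mulr_suml [RHS]big_mkcond; apply: eq_bigr => a _.
by rewrite /moves; case: eqP => _ /=; rewrite ?mulr0.
Qed.

Lemma mean_mart_step e : \sum_a w a * mart_step e (dec a) = 0.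
Proof.
under eq_bigr do rewrite /mart_step mulrBr mulr_sumr.
rewrite sumrB exchange_big -mulr_suml w_sum1 mul1r /=.
under eq_bigr do rewrite mean_moves.
by rewrite -mulr_sumr subrr.
Qed.

Lemma mean_cst c : \sum_a w a * c = c.
Proof. by rewrite -mulr_suml w_sum1 mul1r. Qed.

Lemma Ew_martingale n e : Ew n (martingale e) = 0.
Proof.
elim: n e => [|n IH] e //=.
under eq_bigr do rewrite EwD Ew_cst // IH addr0.
exact: mean_mart_step.
Qed.

Lemma moves_le1 e o : (\sum_(x <- l) moves nx e o x <= 1)%N.
Proof.
case: o => [y|]; last by rewrite big1.
apply: (@leq_trans (\sum_(x <- l) (x == y))).
  by apply: leq_sum => x _; rewrite /moves; case: eqP => [[->]|//]; rewrite eqxx leq_b1.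
by rewrite -big_mkcond /= sum1_count count_uniq_mem ?leq_b1.
Qed.

Lemma actives_bound e : 0 <= actives e <= (size l)%:R.
Proof.
rewrite /actives -natr_sum ler0n ler_nat -sum1_size leq_sum // => x _.
exact: leq_b1.
Qed.

(** At most one particle moves in a step, so the number of moves equals its own square and its
    variance is at most its mean. *)
Lemma mart_step_sqr e : \sum_a w a * mart_step e (dec a) ^+ 2 <= q * (size l)%:R.
Proof.
(* The sign of [q] is read off from a site, so one must exist. *)
have [q0|l0] : 0 <= q \/ l = [::].
  by case: l => [|x l']; [right|left; apply: q_ge0].
  have sqE a : w a * mart_step e (dec a) ^+ 2 =
      w a * (\sum_(x <- l) (moves nx e (dec a) x)%:R)
      - 2 * q * actives e * (w a * mart_step e (dec a))
      - w a * (q * actives e) ^+ 2.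
    rewrite /mart_step; set m := \sum_(x <- l) _.
    have -> : m = (\sum_(x <- l) moves nx e (dec a) x)%N%:R by rewrite natr_sum.
    case: (\sum_(x <- l) _)%N (moves_le1 e (dec a)) => [|[|//]] _; ring.
  under eq_bigr do rewrite sqE.
  rewrite !sumrB -mulr_sumr mean_mart_step mulr0 subr0 -mulr_suml w_sum1 mul1r.
  under eq_bigr do rewrite mulr_sumr.
  rewrite exchange_big /=; under eq_bigr do rewrite mean_moves.
  rewrite -mulr_sumr -/(actives e) lerBlDr ler_wpDr ?sqr_ge0 //.
  by rewrite ler_wpM2l //; case/andP: (actives_bound e).
rewrite /mart_step /actives l0 big1 ?mulr0 // => a _.
by rewrite !big_nil mulr0 subr0 expr0n mulr0.
Qed.

(** Orthogonal increments: the cross term vanishes because the rest of the martingale has mean 0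
    from every configuration. *)
Lemma Ew_martingale_sqr n e :
  Ew n (fun s => martingale e s ^+ 2) <= n%:R * (q * (size l)%:R).
Proof.
elim: n e => [|n IH] e /=; first by rewrite expr0n mul0r.
have stepE a : Ew n (fun s => (mart_step e (dec a) + martingale (step nx e (dec a)) s) ^+ 2)
   = mart_step e (dec a) ^+ 2 + Ew n (fun s => martingale (step nx e (dec a)) s ^+ 2).
  set m := mart_step e (dec a); set e' := step nx e (dec a).
  rewrite (eq_Ew _ _ (g := fun s => (m ^+ 2 + (2 * m) * martingale e' s)
    + martingale e' s ^+ 2)); last by move=> s _; ring.
  by rewrite !EwD EwZ Ew_martingale Ew_cst // mulr0 addr0.
under eq_bigr do rewrite stepE mulrDr.
rewrite big_split -natr1 mulrDl mul1r addrC lerD ?mart_step_sqr //=.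
rewrite -[leRHS]mean_cst; apply: ler_sum => a _.
by rewrite ler_wpM2l.
Qed.

(* Minkowski's inequality along the stationary path, through
   (u + v)^2 <= (n + 1) u^2 + (1 + 1/n) v^2. *)
Lemma Ebern_drift_sqr n :
  Eb (fun e => Ew n (fun s => drift e s ^+ 2)) <=
  n%:R ^+ 2 * (q ^+ 2 * (3 * size l)%:R).
Proof.
set H := q ^+ 2 * _.
have H0 : 0 <= H by rewrite mulr_ge0 ?sqr_ge0 ?ler0n.
pose u e := q * (actives e - (size l)%:R * (r * (1 - r))).
have Eu : Eb (fun e => u e ^+ 2) <= H.
  rewrite (eq_Ebern _ (g := fun e => q ^+ 2 *
    (\sum_(x <- l) (active nx e x)%:R - (size l)%:R * (r * (1 - r))) ^+ 2)).
    by rewrite EbernZ ler_wpM2l ?sqr_ge0 // Ebern_actives.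
  by move=> e; rewrite /u exprMn.
elim: n => [|n IH].
  by rewrite /= (eq_Ebern _ (g := fun=> 0)) ?Ebern_cst ?expr0n ?mul0r.
pose D e := Ew n (fun s => drift e s ^+ 2).
have [n0|n0] := posnP n.
  rewrite n0 /= (eq_Ebern _ (g := fun e => u e ^+ 2)) ?expr1n ?mul1r // => e.
  rewrite -[RHS]mean_cst; apply: eq_bigr => a _.
  by rewrite addr0.
have nR : (0 : R) < n%:R by rewrite ltr0n.
apply: (@le_trans _ _ (Eb (fun e => n.+1%:R * u e ^+ 2 +
    (1 + n%:R^-1) * \sum_a w a * D (step nx e (dec a))))).
  apply: le_Ebern => // e /=.
  rewrite -[n.+1%:R * _]mean_cst mulr_sumr -big_split /=.
  apply: ler_sum => a _; rewrite [_ * (w a * _)]mulrCA -mulrDr ler_wpM2l //.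
  rewrite -(Ew_cst dec w_sum1 n (n.+1%:R * u e ^+ 2)) -EwZ -EwD.
  apply: le_Ew => // s _; rewrite -/(u e); set v := drift _ s; set u' := u e.
  have -> : n.+1%:R * u' ^+ 2 + (1 + n%:R^-1) * v ^+ 2 =
      (u' + v) ^+ 2 + n%:R^-1 * (n%:R * u' - v) ^+ 2.
    by rewrite -natr1; field; apply: lt0r_neq0.
  by rewrite lerDl mulr_ge0 ?sqr_ge0 // invr_ge0 ltW.
rewrite EbernD !EbernZ (Ebern_stationary (q := q) r nx_inj) //.
apply: (@le_trans _ _ (n.+1%:R * H + (1 + n%:R^-1) * (n%:R ^+ 2 * H))).
  by rewrite lerD // ler_wpM2l ?ler0n // addr_ge0 // invr_ge0 ltW.
rewrite le_eqVlt; apply/orP; left; apply/eqP.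
by rewrite -natr1; field; apply: lt0r_neq0.
Qed.

Lemma Ebern_current_sqr n :
  Eb (fun e => Ew n (fun s => (\sum_(x <- l) (current nx e s x)%:R -
      n%:R * (q * (size l)%:R * (r * (1 - r)))) ^+ 2)) <=
  2 * (n%:R * (q * (size l)%:R)) + 2 * (n%:R ^+ 2 * (q ^+ 2 * (3 * size l)%:R)).
Proof.
apply: (@le_trans _ _ (Eb (fun e => 2 * Ew n (fun s => martingale e s ^+ 2) +
    2 * Ew n (fun s => drift e s ^+ 2)))).
  apply: le_Ebern => // e; rewrite -!EwZ -EwD; apply: le_Ew => // s sn.
  rewrite current_decomposition sn addrK.
  have := sqr_ge0 (martingale e s - drift e s); nra.
rewrite EbernD !EbernZ lerD // ler_wpM2l //; last exact: Ebern_drift_sqr.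
rewrite -[leRHS](@Ebern_cst R I r); apply: le_Ebern => // e.
exact: Ew_martingale_sqr.
Qed.

End ring_current.

(** * Dynamics in boxes of the line *)

Section pathwise.
Context {R : realType}.
Implicit Types (W : set (int * R)) (eta : config) (x y z : int) (t s : R)
  (b : int * int) (S : state).

Definition arrows W t b : seq (int * R) :=
  sort (fun p q => p.2 <= q.2) (fset_set (box_arrows W t b)).

Definition later (p q : int * R) := p.2 < q.2.

(** The properties of almost every set of arrows that make the dynamics in boxes well defined; see
    [regular_ae]. *)
Record regular W : Prop := {
  regular_finite : forall t b, finite_set (box_arrows W t b) ;
  regular_times : forall t b p q, box_arrows W t b p -> box_arrows W t b q ->
    p.2 = q.2 -> p = q ;
  regular_left : forall t x, exists2 l, l < x & quiet W t l ;
  regular_right : forall t x, exists2 r, x < r & quiet W t r }.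

Lemma later_trans : transitive later.
Proof. by move=> q p r; apply: lt_trans. Qed.

Lemma later_irr : irreflexive later.
Proof. by move=> p; apply: ltxx. Qed.

Lemma mem_arrows W t b p : regular W -> (p \in arrows W t b) = (p \in box_arrows W t b).
Proof.
move=> regW; rewrite mem_sort in_fset_set //; exact: regular_finite.
Qed.

Lemma arrowsP W t b p : regular W -> reflect (box_arrows W t b p) (p \in arrows W t b).
Proof. by move=> regW; rewrite mem_arrows //; apply: (iffP idP); rewrite inE. Qed.

Lemma sorted_arrows W t b : regular W -> sorted later (arrows W t b).
Proof.
move=> regW.
have le_tr : transitive (fun p q : int * R => p.2 <= q.2).
  by move=> q p r; apply: le_trans.
have le_tot : total (fun p q : int * R => p.2 <= q.2) by move=> p q; apply: le_total.
have := sort_sorted le_tot (fset_set (box_arrows W t b)).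
have : uniq (arrows W t b) by rewrite sort_uniq fset_uniq.
rewrite -/(arrows W t b).
have : forall p, p \in arrows W t b -> box_arrows W t b p.
  by move=> p; rewrite mem_arrows // inE.
rewrite (sorted_pairwise le_tr) (sorted_pairwise later_trans).
elim: (arrows W t b) => [//|p l IH] lW /= /andP[pl ul] /andP[pa ll].
rewrite IH ?andbT //; last by move=> q ql; apply: lW; rewrite inE ql orbT.
apply/allP => q ql; rewrite /later lt_neqAle (allP pa) // andbT.
apply: contra pl => /eqP pq.
by rewrite (regular_times regW (lW p _) (lW q _) pq) // inE ?eqxx ?ql ?orbT.
Qed.

(** A strictly sorted list is determined by its members. Restricting to a smaller box, cutting time
    and concatenating slots all rest on this. *)
Lemma arrowsE W t b l : regular W -> sorted later l ->
  (forall p, p \in l <-> box_arrows W t b p) -> arrows W t b = l.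
Proof.
move=> regW lsort lW; apply: (irr_sorted_eq later_trans later_irr) => //.
  exact: sorted_arrows.
move=> p; rewrite mem_arrows //; apply/idP/idP; rewrite inE => /lW //.
Qed.

Lemma arrows_cat W s t b l : regular W -> 0 <= s -> s <= t -> sorted later l ->
  (forall p, p \in l <-> [/\ W p, b.1 < p.1 < b.2 & s < p.2 <= t]) ->
  arrows W t b = arrows W s b ++ l.
Proof.
move=> regW s0 st lsort lW; apply: arrowsE => //.
  rewrite (sorted_pairwise later_trans) pairwise_cat -!(sorted_pairwise later_trans).
  rewrite lsort sorted_arrows // !andbT; apply/allrelP => p q.
  rewrite mem_arrows // inE => -[_ _ /andP[_ ps]] /lW[_ _ /andP[qs _]].
  exact: le_lt_trans qs.
move=> p; rewrite mem_cat; split => [/orP[|/lW[Wp bp /andP[p0 pt]]]|[Wp bp /andP[p0 pt]]].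
- rewrite mem_arrows // inE => -[Wp bp /andP[p0 ps]]; split => //.
  by rewrite p0 (le_trans ps).
- by split=> //; rewrite pt (le_lt_trans s0).
- rewrite mem_arrows //; case: (leP p.2 s) => ps.
    by apply/orP; left; rewrite inE; split=> //; rewrite p0.
  by apply/orP; right; apply/lW; split=> //; rewrite ps.
Qed.

Lemma box_evolveE W t eta b :
  box_evolve W t eta b = foldl fire (eta, id) [seq p.1 | p <- arrows W t b].
Proof. by []. Qed.

Definition in_box b x := b.1 < x <= b.2.

(** The containment in the second clause makes the relation inductive: an arrow outside the box then
    moves no particle of the box. *)
Definition agree b S S' :=
  (forall x, in_box b x -> S.1 x = S'.1 x) /\
  (forall z, in_box b z -> S.2 z = S'.2 z /\ in_box b (S.2 z)).

(** Only the bonds starting at [b.1] and [b.2] join the box to its complement. *)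
Lemma agree_fire b S S' x : agree b S S' -> x != b.1 -> x != b.2 ->
  agree b (fire S x) (if b.1 < x < b.2 then fire S' x else S').
Proof.
move=> [S1 S2] xb1 xb2; case: ifPn => xb.
  have bx : in_box b x by rewrite /in_box; lia.
  have bx1 : in_box b (x + 1) by rewrite /in_box; lia.
  rewrite /fire !S1 //; case: ifP => // _; split=> [y yb|z zb] /=.
    by rewrite S1.
  by have [<- S2z] := S2 _ zb; split=> //; case: eqP.
rewrite /fire; case: ifP => // _; split=> [y yb|z zb] /=.
  have /negbTE -> : y != x by move: yb; rewrite /in_box; lia.
  have /negbTE -> : y != x + 1 by move: yb; rewrite /in_box; lia.
  exact: S1.
have [<- S2z] := S2 _ zb.
have /negbTE -> : S.2 z != x by move: S2z; rewrite /in_box; lia.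
by [].
Qed.

Lemma agree_foldl b (l : seq int) S S' : agree b S S' ->
  all (fun x => (x != b.1) && (x != b.2)) l ->
  agree b (foldl fire S l) (foldl fire S' [seq x <- l | b.1 < x < b.2]).
Proof.
elim: l S S' => [//|x l IH] S S' SS' /= /andP[/andP[x1 x2] xl].
have := IH _ _ (agree_fire SS' x1 x2) xl.
by case: ifP.
Qed.

Lemma agree_refl b eta : agree b (eta, id) (eta, id).
Proof. by []. Qed.

Lemma arrows_sub W t b b' : regular W -> b'.1 <= b.1 -> b.2 <= b'.2 ->
  arrows W t b = [seq p <- arrows W t b' | b.1 < p.1 < b.2].
Proof.
move=> regW b1 b2; apply: arrowsE => //.
  by apply: sorted_filter; [apply: later_trans|apply: sorted_arrows].
move=> p; rewrite mem_filter; split.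
  by move=> /andP[pb /(arrowsP _ _ _ regW)[Wp _ pt]].
by move=> [Wp pb pt]; rewrite pb; apply/arrowsP => //; split=> //; lia.
Qed.

Lemma quiet_arrows W t b x : regular W -> quiet W t x ->
  all (fun z => z != x) [seq p.1 | p <- arrows W t b].
Proof.
move=> regW qx; apply/allP => z /mapP[[z' u] pW ->] /=; apply/eqP => zx.
move: pW; rewrite mem_arrows // inE => -[Wp _ /= u0t].
by apply: (qx _ u0t); rewrite -zx.
Qed.

Lemma agree_box W t eta b b' : regular W -> b'.1 <= b.1 -> b.2 <= b'.2 ->
  quiet W t b.1 -> quiet W t b.2 ->
  agree b (box_evolve W t eta b') (box_evolve W t eta b).
Proof.
move=> regW b1 b2 q1 q2; rewrite !box_evolveE (arrows_sub t regW b1 b2).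
have -> : [seq p.1 | p <- [seq p <- arrows W t b' | b.1 < p.1 < b.2]] =
    [seq x <- [seq p.1 | p <- arrows W t b'] | b.1 < x < b.2] by rewrite filter_map.
apply: agree_foldl; first exact: agree_refl.
by rewrite all_predI !quiet_arrows.
Qed.

(** The intersection of the two boxes is again bounded by quiet sites, and [agree_box] reduces each
    box to it. *)
Lemma box_evolve_eq W t eta b b' z : regular W ->
  is_box W t z b -> is_box W t z b' ->
  (box_evolve W t eta b).2 z = (box_evolve W t eta b').2 z.
Proof.
move=> regW [zb q1 q2] [zb' q1' q2'].
pose c := (Num.max b.1 b'.1, Num.min b.2 b'.2).
have c1 : quiet W t c.1 by rewrite /c /=; case: leP.
have c2 : quiet W t c.2 by rewrite /c /=; case: leP.
have zc : in_box c z by rewrite /in_box /c /=; lia.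
have [_ /(_ z zc)[-> _]] : agree c (box_evolve W t eta b) (box_evolve W t eta c).
  by apply: agree_box => //=; lia.
have [_ /(_ z zc)[-> //]] : agree c (box_evolve W t eta b') (box_evolve W t eta c).
by apply: agree_box => //=; lia.
Qed.

Lemma box_ofP W t z : regular W -> is_box W t z (box_of W t z).
Proof.
move=> regW; rewrite /box_of; case: xgetP => [b -> //|].
have [l lz ql] := regular_left regW t z.
have [r zr qr] := regular_right regW t z.
by move=> /(_ (l, r)) []; split=> //=; rewrite lz ltW.
Qed.

Lemma tasep_positionE W t eta b z : regular W -> is_box W t z b ->
  tasep_position W eta t z = (box_evolve W t eta b).2 z.
Proof. by move=> regW bz; apply: box_evolve_eq => //; apply: box_ofP. Qed.

Lemma tasep_position_in_box W t eta b z : regular W -> is_box W t z b ->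
  in_box b (tasep_position W eta t z).
Proof.
move=> regW bz; rewrite (tasep_positionE eta regW bz); case: bz => bz q1 q2.
by have [_ /(_ z bz)[]] := agree_box eta regW (lexx b.1) (lexx b.2) q1 q2.
Qed.

Lemma tasep_position_le W t eta x z : regular W -> quiet W t x -> z <= x ->
  tasep_position W eta t z <= x.
Proof.
move=> regW qx zx; have [l lz ql] := regular_left regW t z.
have : is_box W t z (l, x) by split=> //=; rewrite lz.
by move=> /(tasep_position_in_box eta regW) /andP[].
Qed.

Lemma tasep_position_gt W t eta x z : regular W -> quiet W t x -> x < z ->
  x < tasep_position W eta t z.
Proof.
move=> regW qx xz; have [r zr qr] := regular_right regW t z.
have : is_box W t z (x, r) by split=> //=; rewrite xz ltW.
by move=> /(tasep_position_in_box eta regW) /andP[].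
Qed.

Lemma fire_le S x z : S.2 z <= (fire S x).2 z.
Proof. by rewrite /fire; case: ifP => //= _; case: eqP => // ->; lia. Qed.

Lemma foldl_fire_le S l z : S.2 z <= (foldl fire S l).2 z.
Proof. by elim: l S => [//|x l IH] S /=; apply: le_trans (IH _); apply: fire_le. Qed.

Lemma tasep_position_nd W s t eta z : regular W -> 0 <= s -> s <= t ->
  tasep_position W eta s z <= tasep_position W eta t z.
Proof.
move=> regW s0 st; set b := box_of W t z.
have bz : is_box W t z b by apply: box_ofP.
have bzs : is_box W s z b.
  case: bz => bz q1 q2; split=> // u /andP[u0 us]; [apply: q1|apply: q2];
  by rewrite u0 (le_trans us).
rewrite (tasep_positionE eta regW bz) (tasep_positionE eta regW bzs) !box_evolveE.
rewrite (@arrows_cat W s t b [seq p <- arrows W t b | s < p.2]) //.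
- by rewrite map_cat foldl_cat; apply: foldl_fire_le.
- by apply: sorted_filter; [apply: later_trans|apply: sorted_arrows].
- move=> p; rewrite mem_filter; split.
    by move=> /andP[sp /(arrowsP _ _ _ regW)[Wp bp /andP[p0 pt]]]; rewrite sp pt.
  move=> [Wp bp /andP[sp pt]]; rewrite sp; apply/arrowsP => //; split=> //.
  by rewrite pt (le_lt_trans s0).
Qed.

End pathwise.

Section labels.
Implicit Types (eta : config) (x y z : int).

Lemma label_lt eta x y : x < y -> eta y -> label eta x < label eta y.
Proof.
move=> xy etay; rewrite /label; case: (leP x 0) => x0; case: (leP y 0) => y0.
- have -> : `|x|%N = (`|y| + (`|x| - `|y|).-1.+1)%N by lia.
  rewrite iotaD count_cat add0n /= (_ : - `|y|%N%:Z = y) ?etay; lia.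
- have -> : `|y|%N = ((`|y|.-1) + 1)%N by lia.
  rewrite iotaD count_cat /= (_ : (1 + `|y|.-1)%N%:Z = y) ?etay; lia.
- lia.
- have -> : `|y|%N = (`|x| + (`|y| - `|x|).-1 + 1)%N by lia.
  rewrite !iotaD !count_cat /=.
  rewrite (_ : (1 + (`|x| + (`|y| - `|x|).-1))%N%:Z = y) ?etay; lia.
Qed.

Lemma label_inj eta x y : eta x -> eta y -> label eta x = label eta y -> x = y.
Proof.
move=> ex ey xy; case: (ltgtP x y) => // /label_lt.
  by move=> /(_ _ ey); rewrite xy ltxx.
by move=> /(_ _ ex); rewrite xy ltxx.
Qed.

Lemma label_le0 eta x : eta x -> (label eta x <= 0) = (x <= 0).
Proof.
move=> ex; have l0 : label eta 0 = 0 by [].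
case: (leP x 0) => [|x0]; first by rewrite /label => ->; lia.
by apply/negbTE; rewrite -ltNge -l0 label_lt.
Qed.

Lemma start_label eta x : eta x -> start eta (label eta x) = x.
Proof.
move=> ex; rewrite /start; case: xgetP => [z _ [ez]|/(_ x)[]]; last by [].
exact: label_inj.
Qed.

Lemma initially_leftE eta :
  initially_left eta = label eta @` [set x | eta x && (x <= 0)].
Proof.
apply/seteqP; split=> [i [i0 [x ex xi]]|_ [x /andP[ex x0] <-]] /=.
  by exists x => //; rewrite /= ex -(label_le0 ex) xi.
by split; [rewrite label_le0|exists x].
Qed.

Lemma initially_rightE eta :
  initially_right eta = label eta @` [set x | eta x && (0 < x)].
Proof.
apply/seteqP; split=> [i [i0 [x ex xi]]|_ [x /andP[ex x0] <-]] /=.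
  by exists x => //; rewrite /= ex ltNge -(label_le0 ex) xi -ltNge.
by split; [rewrite ltNge label_le0 // -ltNge|exists x].
Qed.

End labels.

Lemma esum_seq (R : realType) (T : choiceType) (Q : pred T) (V : seq T) (f : T -> R) :
  uniq V -> (forall z, 0 <= f z) -> (forall z, Q z -> z \notin V -> f z = 0) ->
  (\esum_(z in [set z | Q z]) (f z)%:E)%E = (\sum_(z <- V | Q z) f z)%:E.
Proof.
move=> V_uniq f0 fV.
transitivity (\esum_(z in [set` V]) (if Q z then f z else 0)%:E)%E.
  rewrite esum_mkcond [RHS]esum_mkcond; apply: eq_esum => z _.
  rewrite !mem_setE /= (_ : (z \in Q) = Q z) //; case: (boolP (Q z)) => Qz;
    case: (boolP (z \in V)) => zV //.
  by rewrite fV.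
rewrite esum_fset; first by rewrite -fsbig_seq // sumEFin -big_mkcond.
  exact: finite_seq.
by move=> z _; rewrite lee_fin; case: ifP.
Qed.

(** * The flux as a count of jumps across a bond *)

Section crossings.
Context {R : realType}.
Implicit Types (W : set (int * R)) (eta : config) (x y z : int) (t : R)
  (b : int * int) (S : state) (V : seq int).

(** Particles that start outside the box stay beyond its quiet ends, which makes both sums finite.
    They merge into one because the indicator of [X <= y] is 1 minus that of [y < X]. *)
Lemma flux_seq W t eta b y V : regular W -> quiet W t b.1 -> quiet W t b.2 ->
  b.1 < 0 <= b.2 -> b.1 <= y <= b.2 -> uniq V -> (forall z, in_box b z -> z \in V) ->
  flux W eta (fun=> y%:~R) t =
   (\sum_(z <- V) (eta z)%:R *
      ((y < tasep_position W eta t z)%R%:R - (0 < z)%R%:R))%:E.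
Proof.
move=> regW q1 q2 b0 yb V_uniq bV.
have label_inj' (Q : pred int) : set_inj [set x | eta x && Q x] (label eta).
  by move=> x1 x2; rewrite !inE => /andP[e1 _] /andP[e2 _]; apply: label_inj.
rewrite /flux initially_leftE initially_rightE !esum_image //.
have posE z : eta z -> particle_position W eta t (label eta z) = tasep_position W eta t z.
  by move=> ez; rewrite /particle_position start_label.
rewrite (eq_esum (b := fun z => ((y < tasep_position W eta t z)%R%:R : R)%:E)); last first.
  by move=> z /andP[ez _]; rewrite posE // ltr_int.
rewrite [X in (_ - X)%E](eq_esum
  (b := fun z => ((tasep_position W eta t z <= y)%R%:R : R)%:E)); last first.
  by move=> z /andP[ez _]; rewrite posE // ler_int.
rewrite (esum_seq (V := V)) //; last first.
  move=> z /andP[ez z0] zV; have zb : z <= b.1.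
    by rewrite leNgt; apply: contra zV => bz; apply: bV; rewrite /in_box; lia.
  have /negbTE -> // : ~~ (y < tasep_position W eta t z).
  by have := tasep_position_le eta regW q1 zb; lia.
rewrite (esum_seq (V := V)) //; last first.
  move=> z /andP[ez z0] zV; have zb : b.2 < z.
    by rewrite ltNge; apply: contra zV => bz; apply: bV; rewrite /in_box; lia.
  have /negbTE -> // : ~~ (tasep_position W eta t z <= y).
  by have := tasep_position_gt eta regW q2 zb; lia.
rewrite -EFinB; congr EFin; rewrite big_mkcond [X in _ - X]big_mkcond -sumrB; apply: eq_bigr => z _.
rewrite !leNgt; case: (eta z); case: (0 < z); case: (y < _) => /=; ring.
Qed.

Definition active_at S x := S.1 x && ~~ S.1 (x + 1).

Fixpoint hops S (l : seq int) y : nat :=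
  if l is x :: l' then ((x == y) && active_at S x) + hops (fire S x) l' y else 0.

(** Links the two components of a state. The test [eta z] discards the positions attached to
    initially empty sites, which [fire] moves as well. *)
Definition occupied_by eta V S b := forall x, in_box b x ->
  (S.1 x : nat) = count (fun z => eta z && (S.2 z == x)) V.

Lemma occupied_fire eta V S b x : b.1 < x < b.2 -> occupied_by eta V S b ->
  occupied_by eta V (fire S x) b.
Proof.
move=> xb occ; rewrite /fire; case: ifP => // /andP[Sx Sx1] y yb /=.
have xb' : in_box b x by rewrite /in_box; lia.
have xb1 : in_box b (x + 1) by rewrite /in_box; lia.
have occx := occ _ xb'; have occx1 := occ _ xb1; rewrite Sx in occx.
rewrite (negbTE Sx1) in occx1.
have [->|yx] := eqVneq y x.
  rewrite (@eq_count _ _ pred0) ?count_pred0 // => z /=.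
  by case: (eta z) => //=; case: (eqVneq (S.2 z) x) => [_|/negbTE //]; lia.
have [->|yx1] := eqVneq y (x + 1).
  transitivity (count (fun z => eta z && (S.2 z == x)) V +
    count (fun z => eta z && (S.2 z == x + 1)%R) V)%N; first by rewrite -occx -occx1.
  elim: V {occ occx occx1} => //= z V <-; case: (eta z) => //=.
  by case: (eqVneq (S.2 z) x) => [->|_]; lia.
rewrite occ //; apply: eq_count => z /=; case: (eta z) => //=.
by case: (eqVneq (S.2 z) x) => // ->; lia.
Qed.

Lemma crossings_fire eta V S b x y : b.1 < x < b.2 -> occupied_by eta V S b ->
  (\sum_(z <- V | eta z) (y < (fire S x).2 z)%R =
   \sum_(z <- V | eta z) (y < S.2 z)%R + ((x == y) && active_at S x))%N.
Proof.
move=> xb occ; rewrite /fire -/(active_at S x); case: ifP => act; last first.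
  by rewrite andbF addn0.
have xb' : in_box b x by rewrite /in_box; lia.
have := occ _ xb'; case/andP: act => -> _; rewrite andbT => occx.
(* Exactly one tracked particle sits at [x], so the jump can be counted particle by particle. *)
have -> : ((x == y) = (x == y) * count (fun z => eta z && (S.2 z == x)) V :> nat)%N.
  by rewrite -occx muln1.
rewrite -sum1_count big_mkcondr /= big_distrr /= -big_split /=.
apply: eq_bigr => z _; case: (eqVneq (S.2 z) x) => [->|_]; lia.
Qed.

Lemma crossings_foldl eta V S b (l : seq int) y : all (fun x => b.1 < x < b.2) l ->
  occupied_by eta V S b ->
  (\sum_(z <- V | eta z) (y < (foldl fire S l).2 z)%R =
   \sum_(z <- V | eta z) (y < S.2 z)%R + hops S l y)%N.
Proof.
elim: l S => [|x l IH] S /=; first by rewrite addn0.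
move=> /andP[xb lb] occ; rewrite IH //; last exact: occupied_fire.
by rewrite (crossings_fire y xb occ) addnA.
Qed.

Lemma occupied_init eta V b : uniq V -> (forall z, in_box b z -> z \in V) ->
  occupied_by eta V (eta, id) b.
Proof.
move=> V_uniq bV x xb /=; have -> : (eta x : nat) = (eta x * (x \in V))%N.
  by rewrite bV // muln1.
rewrite -count_uniq_mem //; elim: V {V_uniq bV} => [|z V IH] /=; first by rewrite muln0.
rewrite -IH mulnDr; congr addn; case: eqP => [->|_]; rewrite ?muln1 ?muln0 ?andbT //.
by rewrite andbF.
Qed.

Lemma flux_hops W t eta b y V : regular W -> quiet W t b.1 -> quiet W t b.2 ->
  b.1 < 0 <= b.2 -> b.1 <= y <= b.2 -> uniq V -> (forall z, in_box b z -> z \in V) ->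
  flux W eta (fun=> y%:~R) t =
   ((hops (eta, id) [seq p.1 | p <- arrows W t b] y)%:R
    + \sum_(z <- V) (eta z)%:R * ((y < z)%R%:R - (0 < z)%R%:R))%:E.
Proof.
move=> regW q1 q2 b0 yb V_uniq bV; rewrite (flux_seq eta regW q1 q2 b0 yb V_uniq bV).
congr EFin; pose pos := tasep_position W eta t; apply/eqP; rewrite -subr_eq -sumrB.
(* Inside the box, positions are those of [box_evolve]; a particle from outside never changes its
   side of [y], so its terms cancel. *)
pose Vb := [seq z <- V | in_box b z].
have Vb_uniq : uniq Vb by rewrite filter_uniq.
have bVb z : in_box b z -> z \in Vb by rewrite mem_filter => zb; rewrite zb bV.
have inner : all (fun x => b.1 < x < b.2) [seq p.1 | p <- arrows W t b].
  by apply/allP => x /mapP[p /(arrowsP _ _ _ regW)[_ pb _] ->].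
have := crossings_foldl y inner (occupied_init eta Vb_uniq bVb).
rewrite -box_evolveE => /(congr1 (fun n => n%:R : R)).
rewrite natrD !natr_sum /= => /eqP; rewrite addrC -subr_eq -sumrB => /eqP <-.
apply/eqP; rewrite big_filter_cond [RHS]big_mkcond; apply: eq_bigr => z _ /=.
rewrite -/pos; have [zb|zb] := boolP (in_box b z).
  have -> : (box_evolve W t eta b).2 z = pos z.
    by rewrite /pos (tasep_positionE eta regW (And3 zb q1 q2)).
  by case: (eta z) => /=; ring.
suff -> : (y < pos z) = (y < z) by case: (eta z) => /=; ring.
move: zb; rewrite /in_box negb_and -leNgt -ltNge => /orP[zb|zb].
  by have := tasep_position_le eta regW q1 zb; rewrite -/(pos z); lia.
by have := tasep_position_gt eta regW q2 zb; rewrite -/(pos z); lia.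
Qed.

(** Particles only move to the right, so each indicator is monotone. Only the values of the barriers
    at the two times enter, which allows comparing a fixed barrier with a moving one. *)
Lemma le_flux W s t eta (y y' : R -> R) : regular W -> 0 <= s -> s <= t -> y' t <= y s ->
  (flux W eta y s <= flux W eta y' t)%E.
Proof.
move=> regW s0 st yy.
have leq_imp (c d : bool) : (c -> d) -> (c <= d)%N by case: c d => [] [] // /(_ isT).
apply: leeB.
  apply: le_esum => i _; rewrite lee_fin ler_nat; apply: leq_imp => ys.
  rewrite (le_lt_trans yy) // (lt_le_trans ys) // ler_int.
  exact: tasep_position_nd.
apply: le_esum => i _; rewrite lee_fin ler_nat; apply: leq_imp => ys.
rewrite (le_trans _ (le_trans ys yy)) // ler_int.
exact: tasep_position_nd.
Qed.

End crossings.

(** * Coupling of the line and the ring *)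

Section ring_coupling.
Context {R : realType} (N M : nat).
Local Notation I := 'I_N.+2.
Implicit Types (W : set (int * R)) (eta : config) (x y z : int) (t : R)
  (b : int * int) (S : state) (i : I) (r : seq (option I)).

(** The shift by [M] puts the origin inside the window. A ring of [N.+2] sites has at least two, as
    [next_neq] requires. *)
Definition site i : int := (i : nat)%:Z - M%:Z.

Definition next : I -> I := @ordS N.+2.

Lemma site_inj : injective site.
Proof. by move=> i j ij; apply: val_inj; move: ij; rewrite /site /=; lia. Qed.

Lemma next_inj : injective next.
Proof. exact: ordS_inj. Qed.

Lemma nextE i : site (next i) = if i == N.+1 :> nat then - M%:Z else site i + 1.
Proof.
rewrite /site /next /=; case: eqP => [->|iN]; first by rewrite modnn; lia.
have iN2 := ltn_ord i.
by rewrite modn_small; lia.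
Qed.

Lemma next_neq i : next i != i.
Proof.
apply/eqP => /(congr1 val) /=; have iN2 := ltn_ord i.
have [->|iN] := eqVneq (i : nat) N.+1; first by rewrite modnn.
by rewrite modn_small; lia.
Qed.

Lemma site_onto x : - M%:Z <= x < N.+2%:Z - M%:Z -> exists i, site i = x.
Proof.
move=> xb; have xN : (absz (x + M%:Z)%R < N.+2)%N by lia.
by exists (Ordinal xN); rewrite /site /=; lia.
Qed.

Definition ring_agree b S (e : {ffun I -> bool}) :=
  forall i, in_box b (site i) -> S.1 (site i) = e i.

Lemma next_in b i : - M%:Z <= b.1 -> b.2 < N.+2%:Z - M%:Z ->
  b.1 < site i < b.2 -> site (next i) = site i + 1.
Proof.
rewrite nextE /site; have := ltn_ord i.
by case: eqP; lia.
Qed.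

(** The delicate bond is the one that closes the ring: it ends at [- M], outside the box because
    [- M <= b.1]. *)
Lemma next_out b i : - M%:Z <= b.1 -> b.2 < N.+2%:Z - M%:Z ->
  site i != b.1 -> site i != b.2 -> ~~ (b.1 < site i < b.2) ->
  ~~ in_box b (site i) /\ ~~ in_box b (site (next i)).
Proof.
rewrite nextE /in_box /site => b1 b2 i1 i2 ib; have := ltn_ord i.
by case: eqP => iN iN2; split; lia.
Qed.

Lemma ring_agree_hop b S e i : - M%:Z <= b.1 -> b.2 < N.+2%:Z - M%:Z ->
  site i != b.1 -> site i != b.2 -> ring_agree b S e ->
  ring_agree b (if b.1 < site i < b.2 then fire S (site i) else S) (hop next e i).
Proof.
move=> b1 b2 i1 i2 Se j jb; case: ifPn => ib.
  have ni := next_in b1 b2 ib.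
  have actE : active next e i = S.1 (site i) && ~~ S.1 (site i + 1).
    by rewrite /active -!Se ?ni // /in_box; lia.
  rewrite /fire /hop actE; case: ifP => [/andP[Si Si1]|_] /=; last exact: Se.
  rewrite ffunE -ni !(inj_eq site_inj); have [->|ji] := eqVneq j i.
    by rewrite tpermL -Se ?ni ?(negbTE Si1) // /in_box; lia.
  have [->|jn] := eqVneq j (next i).
    by rewrite tpermR -Se ?Si // /in_box; lia.
  by rewrite tpermD 1?eq_sym // Se.
have [io no] := next_out b1 b2 i1 i2 ib.
rewrite /hop; case: ifP => _; last exact: Se.
rewrite ffunE tpermD; first exact: Se.
  by apply: contra io => /eqP ->.
by apply: contra no => /eqP ->.
Qed.

Lemma current_hops b S e r i0 : - M%:Z <= b.1 -> b.2 < N.+2%:Z - M%:Z ->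
  b.1 < site i0 < b.2 -> ring_agree b S e ->
  all (fun x => (x != b.1) && (x != b.2)) (map site (pmap id r)) ->
  current next e r i0 =
  hops S [seq x <- map site (pmap id r) | b.1 < x < b.2] (site i0).
Proof.
move=> b1 b2 i0b; elim: r S e => [//|[i|] r IH] S e Se; last first.
  by move=> /IH h /=; rewrite add0n (h S).
move=> /= /andP[/andP[i1 i2] rb]; rewrite (IH _ _ (ring_agree_hop b1 b2 i1 i2 Se) rb).
case: ifPn => ib /=.
  congr (_ + _)%N; rewrite /moves /active_at (inj_eq site_inj) (inj_eq Some_inj).
  case: eqP => //= <-; have ni := next_in b1 b2 ib.
  by rewrite /active -!Se ?ni // /in_box; lia.
rewrite /moves; case: eqP => [[ii0]|//]; by rewrite ii0 i0b in ib.
Qed.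

Lemma flux_ring W t eta b r i0 : regular W -> quiet W t b.1 -> quiet W t b.2 ->
  - M%:Z <= b.1 -> b.2 < N.+2%:Z - M%:Z -> b.1 < 0 <= b.2 -> b.1 < site i0 < b.2 ->
  [seq p.1 | p <- arrows W t (- M%:Z - 1, N.+2%:Z - M%:Z)] = map site (pmap id r) ->
  let e := [ffun i => eta (site i)] in
  flux W eta (fun=> (site i0)%:~R) t =
  ((current next e r i0)%:R
    + \sum_i (e i)%:R * ((site i0 < site i)%R%:R - (0 < site i)%R%:R))%:E.
Proof.
move=> regW q1 q2 b1 b2 b0 i0b rE e.
rewrite (@flux_hops _ W t eta b _ (map site (enum 'I_N.+2))) //; last first.
- move=> z zb; have [i <-] : exists i, site i = z.
    by apply: site_onto; move: zb; rewrite /in_box; lia.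
  by rewrite map_f // mem_enum.
- by rewrite map_inj_uniq ?enum_uniq //; apply: site_inj.
- lia.
congr EFin; congr (_ + _).
  rewrite (@current_hops b (eta, id) e) //.
  - rewrite -rE (@arrows_sub _ W t b (- M%:Z - 1, N.+2%:Z - M%:Z)) //=; try lia.
    by rewrite filter_map.
  - by move=> i _; rewrite ffunE.
  - by rewrite -rE all_predI !quiet_arrows.
rewrite big_map big_enum; apply: eq_bigr => i _.
by rewrite ffunE.
Qed.

End ring_coupling.

(** * Discretization of time into slots *)

Section slots.
Context {R : realType} (N M : nat).
Local Notation I := 'I_N.+2.
Implicit Types (W : set (int * R)) (x : int) (s t lam : R) (i j : I) (k n : nat).

Definition slot_arrows W x s t : set R := [set u | W (x, u) /\ s < u <= t].

Lemma counting_eq0 (A : set R) : counting A = 0%E :> \bar R -> A = set0.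
Proof.
rewrite /counting; case: asboolP => // finA [] /eqP.
rewrite pnatr_eq0 cardfs_eq0 => /eqP A0.
by rewrite -(fset_setK finA) A0 set_fset0.
Qed.

Lemma counting_eq1 (A : set R) : counting A = 1%E :> \bar R -> exists u, A = [set u].
Proof.
rewrite /counting; case: asboolP => // finA [] /eqP.
rewrite (eqr_nat _ _ 1) => /cardfs1P[u Au]; exists u.
by rewrite -(fset_setK finA) Au set_fset1.
Qed.

Definition slot_row W lam k : {ffun I -> bool} :=
  [ffun i => counting (slot_arrows W (site M i) (k%:R * lam) (k.+1%:R * lam))
               != 0%E :> \bar R].

Definition single i : {ffun I -> bool} := [ffun j => j == i].

(** A row with several hits decodes to [None], like an empty one. The word is thus a function of
    independent rows, without conditioning on [good_slots]. *)
Definition row_site (a : {ffun I -> bool}) : option I := [pick i | a == single i].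

Lemma single_inj : injective single.
Proof. by move=> i j /ffunP/(_ i); rewrite !ffunE eqxx => /esym/eqP. Qed.

Lemma row_site_single i : row_site (single i) = Some i.
Proof.
rewrite /row_site; case: pickP => [j /eqP/single_inj -> //|/(_ i)].
by rewrite eqxx.
Qed.

Lemma row_site_eq a i : (row_site a == Some i) = (a == single i).
Proof.
apply/idP/idP => [|/eqP ->]; last by rewrite row_site_single.
by rewrite /row_site; case: pickP => // j /eqP -> /eqP[->].
Qed.

Definition good_slots W lam n := forall k, (k < n)%N ->
  let c i := counting (slot_arrows W (site M i) (k%:R * lam) (k.+1%:R * lam)) : \bar R in
  (forall i, c i = 0%E \/ c i = 1%E) /\ (forall i j, c i <> 0%E -> c j <> 0%E -> i = j).

(** With the strict inequalities of [box_arrows], the sites between these ends are exactly those of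
    the ring. *)
Definition window : int * int := (- M%:Z - 1, N.+2%:Z - M%:Z).

Lemma slot_word W lam n k : good_slots W lam n -> (k < n)%N ->
  exists l : seq (int * R), [/\ sorted later l,
    forall p, p \in l <-> [/\ W p, window.1 < p.1 < window.2 &
      k%:R * lam < p.2 <= k.+1%:R * lam] &
    map fst l = map (site M) (pmap id [:: row_site (slot_row W lam k)])].
Proof.
move=> good kn.
pose c i : \bar R := counting (slot_arrows W (site M i) (k%:R * lam) (k.+1%:R * lam)).
have [c01 cinj] : (forall i, c i = 0%E \/ c i = 1%E) /\
  (forall i j, c i <> 0%E -> c j <> 0%E -> i = j) := good k kn.
have in_window x : window.1 < x < window.2 -> exists i, x = site M i.
  rewrite /window /= => xw; have [i <-] : exists i, site M i = x :> int.
    by apply: site_onto; lia.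
  by exists i.
have site_window i : window.1 < site M i < window.2.
  by rewrite /window /site /=; have := ltn_ord i; lia.
have [[i ci]|c0] := pselect (exists i, c i <> 0%E).
  have [u iu] : exists u, slot_arrows W (site M i) (k%:R * lam) (k.+1%:R * lam) = [set u].
    by apply: counting_eq1; case: (c01 i).
  exists [:: (site M i, u)]; split=> //.
    move=> p; rewrite inE; split.
      move=> /eqP -> /=; have : [set u] u by [].
      by rewrite -iu => -[].
    case: p => x v [Wp /in_window[j /= xj] /= kv]; rewrite xj in Wp *.
    have cj : c j <> 0%E.
      by move=> /counting_eq0 j0; have : (set0 : set R) v by rewrite -j0; split.
    have ji := cinj _ _ cj ci; rewrite ji in Wp *.
    by have -> : v = u; [have : [set u] v by rewrite -iu; split|].
  suff -> : slot_row W lam k = single i by rewrite row_site_single.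
  apply/ffunP => j; rewrite !ffunE -/(c j); apply/idP/eqP => [/eqP cj|->]; last exact/eqP.
  exact: cinj.
have row0 i : slot_row W lam k != single i.
  apply/eqP => /ffunP/(_ i); rewrite !ffunE eqxx => /eqP ci.
  by apply: c0; exists i.
exists [::]; split=> //.
  case=> x v; split=> // -[Wp /in_window[j /= xj] /= kv]; rewrite xj in Wp.
  have /counting_eq0 j0 : c j = 0%E.
    by case: (pselect (c j = 0%E)) => // cj; case: c0; exists j.
  by have : (set0 : set R) v by rewrite -j0; split.
by rewrite /row_site; case: pickP => // i; rewrite (negbTE (row0 i)).
Qed.

(** The word forgets exact times, but with at most one arrow per slot the order of the slots is the
    order of time. *)
Lemma window_arrows W lam n : 0 <= lam -> good_slots W lam n ->
  exists l : seq (int * R), [/\ sorted later l,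
    forall p, p \in l <-> box_arrows W (n%:R * lam) window p &
    map fst l = map (site M) (pmap id (map row_site (mkseq (slot_row W lam) n)))].
Proof.
move=> lam0; elim: n => [|n IH] good.
  by exists [::]; split=> // p; split=> // -[_ _ /andP[p0]]; rewrite mul0r leNgt p0.
have [l [lsort lW lE]] := slot_word good (ltnSn n).
have [l' [l'sort l'W l'E]] : exists l : seq (int * R), [/\ sorted later l,
    forall p, p \in l <-> box_arrows W (n%:R * lam) window p &
    map fst l = map (site M) (pmap id (map row_site (mkseq (slot_row W lam) n)))].
  by apply: IH => k kn; apply: good; rewrite ltnS ltnW.
have nlam : n%:R * lam <= n.+1%:R * lam by rewrite ler_wpM2r // ler_nat.
exists (l' ++ l); split.
- rewrite (sorted_pairwise (@later_trans _)) pairwise_cat.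
  rewrite -!(sorted_pairwise (@later_trans _)) lsort l'sort !andbT; apply/allrelP => p q.
  move=> /l'W[_ _ /andP[_ pn]] /lW[_ _ /andP[nq _]].
  exact: le_lt_trans nq.
- move=> p; rewrite mem_cat; split=> [/orP[/l'W[Wp wp /andP[p0 pn]]|/lW[Wp wp /andP[np pn]]]|].
  + by split=> //; rewrite p0 (le_trans pn).
  + by split=> //; rewrite pn (le_lt_trans _ np) // mulr_ge0.
  + move=> [Wp wp /andP[p0 pn]]; case: (leP p.2 (n%:R * lam)) => np; apply/orP.
      by left; apply/l'W; split=> //; rewrite p0.
    by right; apply/lW; split=> //; rewrite np.
- by rewrite map_cat l'E lE mkseqS map_rcons -cats1 pmap_cat map_cat.
Qed.

Lemma arrows_word W lam n : regular W -> 0 <= lam -> good_slots W lam n ->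
  [seq p.1 | p <- arrows W (n%:R * lam) window] =
  map (site M) (pmap id (map row_site (mkseq (slot_row W lam) n))).
Proof.
move=> regW lam0 /(window_arrows lam0)[l [lsort lW lE]].
by rewrite (arrowsE regW lsort lW).
Qed.

(** Finiteness and distinct times follow from good slots, so one probability estimate serves both
    the coupling and [regular_ae]. *)
Lemma good_slots_regular W lam n t (b : int * int) : 0 <= lam -> good_slots W lam n ->
  t <= n%:R * lam -> window.1 <= b.1 -> b.2 <= window.2 ->
  finite_set (box_arrows W t b) /\ forall p q, box_arrows W t b p ->
    box_arrows W t b q -> p.2 = q.2 -> p = q.
Proof.
move=> lam0 /(window_arrows lam0)[l [lsort lW _]] tn b1 b2.
have bl p : box_arrows W t b p -> p \in l.
  move=> [Wp pb /andP[p0 pt]]; apply/lW; split=> //; first by lia.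
  by rewrite p0 (le_trans pt).
split; first by apply: sub_finite_set (finite_seq l).
move=> p q /bl pl /bl ql; elim: l lsort pl ql {lW bl} => // r l IH.
rewrite (sorted_pairwise (@later_trans _)) /= => /andP[/allP rl ll].
rewrite !inE => /predU1P[->|pl] /predU1P[->|ql] // pq.
- by have := rl _ ql; rewrite /later pq ltxx.
- by have := rl _ pl; rewrite /later pq ltxx.
- by apply: IH => //; rewrite (sorted_pairwise (@later_trans _)).
Qed.

End slots.

(** * Law of the arrows and of the initial configuration *)

Section small_sets.
Context {R : realType} {d : measure_display} {T : measurableType d}.
Context (P : probability T R).
Implicit Types (A B : set T) (x y : R).

(* Upper bounds on the outer measure spare measurability proofs for the events. *)
Definition small A x := exists B, [/\ measurable B, A `<=` B & (P B <= x%:E)%E].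

Lemma smallS A B x y : A `<=` B -> x <= y -> small B x -> small A y.
Proof.
move=> AB xy [C [mC BC PC]]; exists C; split=> //.
  exact: subset_trans BC.
by rewrite (le_trans PC) // lee_fin.
Qed.

Lemma small_measurable A x : measurable A -> (P A <= x%:E)%E -> small A x.
Proof. by move=> mA PA; exists A; split. Qed.

Lemma smallU A B x y : small A x -> small B y -> small (A `|` B) (x + y).
Proof.
move=> [C [mC AC PC]] [D [mD BD PD]]; exists (C `|` D); split.
- exact: measurableU.
- exact: setUSS.
- by rewrite EFinD (le_trans (measureU2 _ mC mD)) // leeD.
Qed.

Lemma small0 : small set0 0.
Proof. by apply: small_measurable; rewrite ?measure0. Qed.

Lemma small_seq (I : eqType) (l : seq I) (A : I -> set T) (x : I -> R) :
  (forall i, i \in l -> small (A i) (x i)) ->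
  small [set w | exists2 i, i \in l & A i w] (\sum_(i <- l) x i).
Proof.
elim: l => [|i l IH] Ax.
  by rewrite big_nil; apply: smallS (lexx _) small0 => w [].
rewrite big_cons; apply: (smallS _ (lexx _) (smallU (Ax i _) (IH _))).
- by move=> w [j]; rewrite inE => /predU1P[->|jl] Aj; [left|right; exists j].
- by rewrite inE eqxx.
- by move=> j jl; apply: Ax; rewrite inE jl orbT.
Qed.

Lemma small_negligible A : (forall e, 0 < e -> small A e) -> P.-negligible A.
Proof.
move=> Ae; have inv0 n : (0 : R) < n.+1%:R^-1 by rewrite invr_gt0 ltr0n.
have [B BP] := choice (fun n => Ae _ (inv0 n)).
exists (\bigcap_n B n); split.
- by apply: bigcap_measurableType => n _; case: (BP n).
- apply/eqP; rewrite eq_le measure_ge0 andbT; apply/lee_addgt0Pr => e e0.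
  rewrite add0e.
  have [n ne] : exists n : nat, n.+1%:R^-1 < e.
    exists (Num.truncn e^-1); rewrite invf_plt ?posrE ?ltr0n //.
    by rewrite truncnS_gt // ltW // invr_gt0.
  case: (BP n) => mB _ PB; apply: (@le_trans _ _ (P (B n))).
    apply: le_measure; rewrite ?inE //.
      by apply: bigcap_measurableType => k _; case: (BP k).
    exact: bigcap_inf.
  by rewrite (le_trans PB) // lee_fin ltW.
- by move=> w Aw n _; case: (BP n) => _ AB _; apply: AB.
Qed.

Lemma small_borel_cantelli (A : nat -> set T) (x : nat -> R) :
  (forall k, small (A k) (x k)) -> (\sum_(k <oo) (x k)%:E < +oo)%E ->
  P.-negligible [set w | forall n, exists2 k, (n <= k)%N & A k w].
Proof.
move=> Ax x_sum; have [B BP] := choice Ax.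
have mB k : measurable (B k) by case: (BP k).
exists (lim_sup_set B); split.
- apply: bigcap_measurableType => n _; apply: bigcup_measurable => k _; exact: mB.
- apply: lim_sup_set_cvg0 => //; apply: le_lt_trans x_sum.
  by apply: lee_nneseries => // k _; case: (BP k).
- move=> w Aw n _; have [k nk Akw] := Aw n; exists k => //.
  by case: (BP k) => _ AB _; apply: AB.
Qed.

End small_sets.

Section independence.
Context {R : realType} {d : measure_display} {T : measurableType d}.
Context (P : probability T R).

Lemma independent_seq (I : choiceType) (G : I -> set (set T)) (l : seq I) (A : I -> set T) :
  mutually_independent P G -> uniq l -> (forall i, G i (A i)) ->
  P [set w | forall i, i \in l -> A i w] = (\prod_(i <- l) P (A i))%E.
Proof.
move=> indG l_uniq GA; have := indG (seq_fset tt l) A (fun i _ => GA i).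
have -> : (\prod_(i <- seq_fset tt l) P (A i) = \prod_(i <- l) P (A i))%E.
  by apply: perm_big; rewrite -[X in perm_eq _ X]undup_id ?seq_fset_perm.
move=> <-; congr (P _); apply/seteqP; split=> w Aw i il; apply: Aw.
  by have : i \in seq_fset tt l := il; rewrite seq_fsetE.
by suff : i \in seq_fset tt l by []; rewrite seq_fsetE.
Qed.

Lemma sigma_seq (I : eqType) (X : set (set T)) (l : seq I) (A : I -> set T) :
  (forall i, i \in l -> <<s X>> (A i)) -> <<s X>> [set w | forall i, i \in l -> A i w].
Proof.
elim: l => [|i l IH] XA.
  rewrite (_ : mkset _ = setT); last by apply/seteqP; split.
  exact: (@measurableT _ (g_sigma_algebraType X)).
rewrite (_ : mkset _ = A i `&` [set w | forall j, j \in l -> A j w]).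
  apply: (@measurableI _ (g_sigma_algebraType X)).
    by apply: XA; rewrite inE eqxx.
  by apply: IH => j jl; apply: XA; rewrite inE jl orbT.
apply/seteqP; split=> w /= => [Aw|[Aiw Aw] j].
  by split=> [|j jl]; apply: Aw; rewrite inE ?eqxx ?jl ?orbT.
by rewrite inE => /predU1P[->|] //; apply: Aw.
Qed.

Lemma measurable_seq (I : eqType) (l : seq I) (A : I -> set T) :
  (forall i, i \in l -> measurable (A i)) -> measurable [set w | forall i, i \in l -> A i w].
Proof.
elim: l => [|i l IH] mA.
  by rewrite (_ : mkset _ = setT) //; apply/seteqP; split.
rewrite (_ : mkset _ = A i `&` [set w | forall j, j \in l -> A j w]).
  apply: measurableI; first by apply: mA; rewrite inE eqxx.
  by apply: IH => j jl; apply: mA; rewrite inE jl orbT.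
apply/seteqP; split=> w /= => [Aw|[Aiw Aw] j].
  by split=> [|j jl]; apply: Aw; rewrite inE ?eqxx ?jl ?orbT.
by rewrite inE => /predU1P[->|] //; apply: Aw.
Qed.

Lemma sigma_join_sub (I : Type) (G : I -> set (set T)) i A : G i A -> sigma_join G A.
Proof. by move=> GA; apply: sub_gen_smallest; exists i. Qed.

End independence.

(** * Law of the inputs restricted to a window *)

Section input_law.
Context {R : realType} {d : measure_display} {T : measurableType d}.
Context {P : probability T R}.
Context {U : int -> {RV P >-> R}} {omega : T -> set (int * R)}.
Context (U_unif : iid_uniform U) (omega_poisson : poisson_process P omega).
Context (U_omega : independent_inputs omega U).
Context (rho : R) (rho01 : 0 <= rho <= 1).
Implicit Types (x : int) (s t lam : R) (b : bool).

Definition occ x b : set T := [set w | (U x w < rho) = b].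

Lemma occ_sigma x b : g_sigma_algebra_preimage (U x) (occ x b).
Proof.
exists [set u | (u < rho) = b]; last by rewrite setTI.
case: b.
  by rewrite (_ : mkset _ = `]-oo, rho[%classic) //; apply/seteqP; split=> u /=; rewrite in_itv.
rewrite (_ : mkset _ = `[rho, +oo[%classic) //.
apply/seteqP; split=> u /=; rewrite in_itv /= andbT.
  by move=> /negbT; rewrite -leNgt.
by rewrite leNgt => /negbTE.
Qed.

Lemma measurable_occ x b : measurable (occ x b).
Proof.
have [B mB <-] := occ_sigma x b.
exact: (@measurable_funPT _ _ _ _ (U x)).
Qed.

Lemma P_occ x b : P (occ x b) = (bern rho b)%:E.
Proof.
have P1 : P (occ x true) = rho%:E.
  have := U_unif.1 x `]-oo, rho[%classic (measurable_itv _).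
  rewrite /distribution /pushforward (_ : U x @^-1` _ = occ x true); last first.
    by apply/seteqP; split=> w /=; rewrite in_itv.
  move=> ->; rewrite /uniform_prob integral_uniform_pdf.
  rewrite (eq_integral (fun=> 1%E)); last first.
    by move=> u; rewrite inE /= => -[_]; rewrite in_itv /= /uniform_pdf => ->; rewrite subr0 invr1.
  rewrite integral_cst; last exact: measurableI.
  case/andP: rho01 => r0 r1.
  rewrite (_ : _ `&` _ = `[0, rho[%classic).
    rewrite mul1e /= lebesgue_measure_itv /= lte_fin; case: ltP => [_|r0'].
      by rewrite -EFinB subr0.
    by congr EFin; apply/eqP; rewrite eq_le r0.
  apply/seteqP; split=> u /=; rewrite !in_itv /=; lra.
case: b => //; rewrite (_ : occ x false = ~` occ x true).
  by rewrite probability_setC ?P1 //; apply: measurable_occ.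
by apply/seteqP; split=> w; rewrite /occ /=; [move=> -> | move=> /negP/negbTE].
Qed.

Lemma arrow_count_sigma x s t (A : set (\bar R)) : 0 <= s <= t -> measurable A ->
  g_sigma_algebra_preimage (arrow_count omega x s t) (arrow_count omega x s t @^-1` A).
Proof. by move=> st mA; exists A => //; rewrite setTI. Qed.

Lemma measurable_arrow_count x s t (A : set (\bar R)) : 0 <= s <= t -> measurable A ->
  measurable (arrow_count omega x s t @^-1` A).
Proof.
move=> st mA; rewrite -[X in measurable X]setTI.
by apply: (poisson_measurable omega_poisson x st).
Qed.

Lemma sigma_arrows_count x s t (A : set (\bar R)) : 0 <= s <= t -> measurable A ->
  sigma_arrows omega x (arrow_count omega x s t @^-1` A).
Proof.
by move=> st mA; apply: (sigma_join_sub (i := exist _ (s, t) st)); apply: arrow_count_sigma.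
Qed.

Definition nonzero b : set (\bar R) := [set c | (c != 0%E) = b].

Lemma measurable_nonzero b : measurable (nonzero b).
Proof.
case: b.
  rewrite (_ : nonzero true = ~` [set 0%E]); first exact/measurableC/emeasurable_set1.
  by apply/seteqP; split=> c /=; [move/eqP | move=> c0; apply/eqP].
rewrite (_ : nonzero false = [set 0%E]); first exact/emeasurable_set1.
by apply/seteqP; split=> c /=; [move/negbFE/eqP | move=> ->; rewrite /nonzero /= eqxx].
Qed.

(** Probability that a rate-1 Poisson process has a point in an interval of length [lam]. *)
Definition hit_rate lam : R := 1 - expR (- lam).

Lemma hit_rate01 lam : 0 <= lam -> 0 <= hit_rate lam <= 1.
Proof.
by move=> l0; rewrite /hit_rate subr_ge0 expR_le1 oppr_le0 l0 /= gerBl expR_ge0.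
Qed.

Lemma hit_rate_le lam : hit_rate lam <= lam.
Proof. by have := expR_ge1Dx (- lam); rewrite /hit_rate; lra. Qed.

Lemma P_nonzero x s t b : 0 <= s < t ->
  P (arrow_count omega x s t @^-1` nonzero b) = (bern (hit_rate (t - s)) b)%:E.
Proof.
move=> st; have st' : 0 <= s <= t by case/andP: st => -> /ltW.
have P0 : P (arrow_count omega x s t @^-1` nonzero false) = (expR (- (t - s)))%:E.
  have := poisson_law omega_poisson x 0 st; rewrite /poisson_pmf subr_gt0.
  case/andP: (st) => _ ->; rewrite expr0 fact0 invr1 !mul1r => <-; congr (P _).
  by apply/seteqP; split=> w /=; [move/negbFE/eqP | move=> c0; rewrite /nonzero /= c0 eqxx].
case: b; last by rewrite P0 /= /hit_rate subKr.
rewrite (_ : _ @^-1` _ = ~` (arrow_count omega x s t @^-1` nonzero false)).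
  rewrite probability_setC ?P0 //; apply: measurable_arrow_count => //.
  exact: measurable_nonzero.
by apply/seteqP; split=> w; rewrite /nonzero /=; case: (_ != _).
Qed.

(** With [h = t - s] the probability is [1 - (1 + h) exp(-h)], and [exp(-h) >= 1 - h] bounds it by
    [h^2]. *)
Lemma P_not01 x s t : 0 <= s < t ->
  small P [set w | ~ (arrow_count omega x s t w = 0%E \/ arrow_count omega x s t w = 1%E)]
    ((t - s) ^+ 2).
Proof.
move=> st; have st' : 0 <= s <= t by case/andP: st => -> /ltW.
have ts0 : 0 < t - s by case/andP: st => _; rewrite subr_gt0.
pose E n := [set w | arrow_count omega x s t w = n%:R%:E].
have mE n : measurable (E n).
  by apply: (measurable_arrow_count x st' (A := [set n%:R%:E])); apply: emeasurable_set1.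
have PE n : P (E n) = (poisson_pmf (t - s) n)%:E := poisson_law omega_poisson x n st.
apply: small_measurable.
  rewrite (_ : mkset _ = ~` (E 0%N `|` E 1%N)) //.
  by apply: measurableC; apply: measurableU.
rewrite (_ : mkset _ = ~` (E 0%N `|` E 1%N)) // probability_setC; last exact: measurableU.
rewrite measureU //; last first.
  by apply/seteqP; split=> w //= -[]; rewrite /E /= => -> [] /eqP; rewrite eq_sym oner_eq0.
rewrite [X in (_ - (X + _))%E]PE [X in (_ - (_ + X))%E]PE /poisson_pmf ts0.
rewrite -EFinD lee_fin expr0 expr1 fact0 invr1 !mul1r mulr1.
have := expR_ge1Dx (- (t - s)); nra.
Qed.

Lemma P_two_hits x y s t : 0 <= s < t -> x != y ->
  small P [set w | arrow_count omega x s t w <> 0%E /\ arrow_count omega y s t w <> 0%E]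
    ((t - s) ^+ 2).
Proof.
move=> st xy; have st' : 0 <= s <= t by case/andP: st => -> /ltW.
have ts0 : 0 <= t - s by case/andP: st => _; rewrite subr_ge0 => /ltW.
pose A z := arrow_count omega z s t @^-1` nonzero true.
have mA z : measurable (A z).
  by apply: measurable_arrow_count => //; apply: measurable_nonzero.
have AE : [set w | arrow_count omega x s t w <> 0%E /\ arrow_count omega y s t w <> 0%E] =
    [set w | forall z, z \in [:: x; y] -> A z w].
  apply/seteqP; split=> w /=.
    by move=> [/eqP wx /eqP wy] z; rewrite !inE => /orP[] /eqP ->.
  by move=> Aw; split; apply/eqP; apply: Aw; rewrite !inE eqxx ?orbT.
have PA : P [set w | forall z, z \in [:: x; y] -> A z w] =
    (\prod_(z <- [:: x; y]) P (A z))%E.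
  apply: (independent_seq (poisson_sites omega_poisson)); first by rewrite /= inE xy.
  by move=> z; apply: sigma_arrows_count => //; apply: measurable_nonzero.
rewrite AE; apply: small_measurable.
  rewrite -AE (_ : mkset _ = A x `&` A y); first exact: measurableI.
  by apply/seteqP; split=> w /= [] /eqP ? /eqP ?.
rewrite PA big_cons big_seq1 !P_nonzero //= -EFinM lee_fin.
by have := hit_rate_le (t - s); have := hit_rate01 ts0; nra.
Qed.

(** Union bound: in each slot, one of [N.+2] sites is hit more than once or one of [N.+2 ^ 2]
    ordered pairs of sites is hit twice over, each at cost [lam ^+ 2]. For fixed [n * lam] the total
    is of order [1 / n]. *)
Lemma small_bad_slots N M lam n : 0 < lam ->
  small P [set w | ~ good_slots N M (omega w) lam n]
    (n%:R * ((N.+2%:R + N.+2%:R ^+ 2) * lam ^+ 2)).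
Proof.
move=> lam0.
have slot_len k : 0 <= k%:R * lam < k.+1%:R * lam.
  apply/andP; split; first by apply: mulr_ge0; [apply: ler0n|apply: ltW].
  by rewrite ltr_pM2r // ltr_nat.
have slotE k : k.+1%:R * lam - k%:R * lam = lam by rewrite -mulrBl -natr1 addrC addKr mul1r.
pose c k (i : 'I_N.+2) := arrow_count omega (site M i) (k%:R * lam) (k.+1%:R * lam).
have sumI (z : R) : \sum_(i <- enum 'I_N.+2) z = N.+2%:R * z.
  by rewrite big_enum /= sumr_const card_ord mulr_natl.
have -> : n%:R * ((N.+2%:R + N.+2%:R ^+ 2) * lam ^+ 2) =
    \sum_(k <- iota 0 n) (\sum_(i <- enum 'I_N.+2) lam ^+ 2 +
      \sum_(i <- enum 'I_N.+2) \sum_(j <- enum 'I_N.+2) lam ^+ 2).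
  rewrite !sumI big_const_seq count_predT size_iota iter_addr_0 -[RHS]mulr_natl.
  by congr (_ * _); ring.
apply: (smallS (B := [set w | exists2 k, k \in iota 0 n &
   ([set w | exists2 i, i \in enum 'I_N.+2 & ~ (c k i w = 0%E \/ c k i w = 1%E)] `|`
    [set w | exists2 i, i \in enum 'I_N.+2 & exists2 j, j \in enum 'I_N.+2 &
       (i != j /\ (c k i w <> 0%E /\ c k j w <> 0%E))]) w]) _ (lexx _)).
  move=> w bad; apply: contrapT => noex; apply: bad => k kn; split=> [i|i j ci cj].
    apply: contrapT => ci; apply: noex; exists k; first by rewrite mem_iota.
    by left; exists i; rewrite ?mem_enum.
  apply: contrapT => ij; apply: noex; exists k; first by rewrite mem_iota.
  by right; exists i; rewrite ?mem_enum //; exists j; rewrite ?mem_enum //; split=> //; apply/eqP.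
apply: small_seq => k _; apply: smallU; apply: small_seq => i _.
  by rewrite -[lam in lam ^+ 2](slotE k); apply: P_not01.
(* Diagonal pairs give the empty event; they are kept so that the sum runs over a full square. *)
apply: small_seq => j _; have [->|ij] := eqVneq i j.
  by apply: smallS (sqr_ge0 _) (small0 P) => w /= [].
rewrite -[lam in lam ^+ 2](slotE k).
apply: (smallS _ (lexx _) (P_two_hits (slot_len k) (_ : site M i != site M j))).
  by move=> w [].
by rewrite (inj_eq (@site_inj _ _)).
Qed.

Lemma small_no_quiet t (l : seq int) : 0 < t -> uniq l ->
  small P [set w | forall x, x \in l -> ~ quiet (omega w) t x] (hit_rate t ^+ size l).
Proof.
move=> t0 l_uniq; have t00 : (0 : R) <= 0 < t by rewrite lexx.
have t00' : (0 : R) <= 0 <= t by rewrite lexx ltW.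
pose A z := arrow_count omega z 0 t @^-1` nonzero true.
have mA z : measurable (A z).
  by apply: measurable_arrow_count => //; apply: measurable_nonzero.
apply: (smallS (B := [set w | forall x, x \in l -> A x w]) _ (lexx _)).
  move=> w noq x xl; rewrite /A /nonzero /=; apply/eqP => c0; apply: (noq x xl).
  move=> s st Ws; have := counting_eq0 c0 => /seteqP[+ _] => /(_ s); apply.
  by split.
apply: small_measurable.
  exact: measurable_seq.
rewrite (independent_seq (poisson_sites omega_poisson)) //; last first.
  by move=> z; apply: sigma_arrows_count => //; apply: measurable_nonzero.
under eq_bigr do rewrite P_nonzero // subr0.
by rewrite prodEFin big_const_seq count_predT iter_mulr_1 /=.
Qed.

Section finite_law.
Context (N M : nat) (lam : R) (lam0 : 0 < lam) (n : nat).
Local Notation I := 'I_N.+2.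
Local Notation conf := {ffun I -> bool}.

Definition ring_conf w : conf := [ffun i => bernoulli_config U rho w (site M i)].

Definition ring_rows w : seq conf := mkseq (slot_row N M (omega w) lam) n.

Definition ring_word w : seq (option I) := map (@row_site N) (ring_rows w).

Let sites : seq int := map (site M) (enum I).

Let sites_uniq : uniq sites.
Proof. by rewrite map_inj_uniq ?enum_uniq //; apply: site_inj. Qed.

(** The independence hypotheses are indexed by all integers, so data of the ring need a value at
    every site; outside the ring it is arbitrary. *)
Definition extend (e : conf) x : bool :=
  if [pick i | site M i == x] is Some i then e i else false.

Lemma extend_site e i : extend e (site M i) = e i.
Proof.
rewrite /extend; case: pickP => [j /eqP/site_inj -> //|/(_ i)].
by rewrite eqxx.
Qed.

Let slot_len k : 0 <= k%:R * lam < k.+1%:R * lam.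
Proof.
apply/andP; split; first by apply: mulr_ge0; [apply: ler0n|apply: ltW].
by rewrite ltr_pM2r // ltr_nat.
Qed.

Let slot_len' k : 0 <= k%:R * lam <= k.+1%:R * lam.
Proof. by case/andP: (slot_len k) => -> /ltW. Qed.

Let slotE k : k.+1%:R * lam - k%:R * lam = lam.
Proof. by rewrite -mulrBl -natr1 addrC addKr mul1r. Qed.

Definition hit x k b : set T :=
  arrow_count omega x (k%:R * lam) (k.+1%:R * lam) @^-1` nonzero b.

Definition atom (e : conf) (s : seq conf) : set T :=
  [set w | ring_conf w = e /\ ring_rows w = s].

Lemma P_hits x (f : nat -> bool) :
  P [set w | forall k, k \in iota 0 n -> hit x k (f k) w] =
  (\prod_(k <- iota 0 n) (bern (hit_rate lam) (f k))%:E)%E.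
Proof.
have s0 : 0 <= 0%:R * lam by rewrite mul0r.
have smono k : k%:R * lam <= k.+1%:R * lam by case/andP: (slot_len' k).
have indep := poisson_increments omega_poisson (x := x) (s := fun k => k%:R * lam) s0 smono.
rewrite (independent_seq indep) ?iota_uniq //.
  by apply: eq_bigr => k _; rewrite P_nonzero // slotE.
by move=> k; apply: arrow_count_sigma => //; apply: measurable_nonzero.
Qed.

(** Independence of the two inputs, of the sites and of the slots yields exactly the weights of
    [Ebern] and [Ew], which transfers the estimates on the ring to [P]. *)
Lemma P_atom e (s : n.-tuple conf) :
  P (atom e s) = (bern_prod rho e * \prod_(a <- s) bern_prod (hit_rate lam) a)%:E /\
  measurable (atom e s).
Proof.
pose a0 : conf := [ffun=> false].
pose A := [set w | forall x, x \in sites -> occ x (extend e x) w].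
pose B := [set w | forall x, x \in sites ->
  [set w | forall k, k \in iota 0 n -> hit x k (extend (nth a0 s k) x) w] w].
have AB : atom e s = A `&` B.
  apply/seteqP; split=> w.
    move=> [we ws]; split=> x /mapP[i _ ->].
      by rewrite extend_site -we ffunE.
    move=> k kn; rewrite extend_site -ws nth_mkseq ?ffunE //.
    by move: kn; rewrite mem_iota.
  move=> [Aw Bw]; split.
    apply/ffunP => i; rewrite ffunE; have := Aw _ (map_f (site M) (mem_enum I i)).
    by rewrite extend_site.
  apply: (@eq_from_nth _ a0); first by rewrite size_mkseq size_tuple.
  move=> k; rewrite size_mkseq => kn; rewrite nth_mkseq //; apply/ffunP => i.
  rewrite ffunE; have := Bw _ (map_f (site M) (mem_enum I i)) k.
  by rewrite mem_iota kn extend_site => /(_ isT).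
have Asig : sigma_join (fun x => g_sigma_algebra_preimage (U x)) A.
  by apply: sigma_seq => x _; apply: (sigma_join_sub (i := x)); apply: occ_sigma.
have Bxsig x : sigma_arrows omega x
    [set w | forall k, k \in iota 0 n -> hit x k (extend (nth a0 s k) x) w].
  apply: sigma_seq => k _; apply: sigma_arrows_count => //.
  exact: measurable_nonzero.
have Bsig : sigma_join (sigma_arrows omega) B.
  by apply: sigma_seq => x _; apply: (sigma_join_sub (i := x)).
have PA : P A = (bern_prod rho e)%:E.
  rewrite /A (independent_seq U_unif.2) //; last by move=> x; apply: occ_sigma.
  rewrite /sites big_map big_enum /= /bern_prod -prodEFin.
  by apply: eq_bigr => i _; rewrite P_occ extend_site.
have PB : P B = (\prod_(a <- s) bern_prod (hit_rate lam) a)%:E.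
  rewrite /B (independent_seq (poisson_sites omega_poisson)) //.
  rewrite /sites big_map big_enum /=.
  under eq_bigr do rewrite P_hits prodEFin.
  rewrite prodEFin exchange_big /= (big_nth a0) size_tuple /index_iota subn0.
  congr EFin; apply: eq_bigr => k _; apply: eq_bigr => i _.
  by rewrite extend_site.
split; first by rewrite AB U_omega // PA PB.
rewrite AB; apply: measurableI.
  by apply: measurable_seq => x _; apply: measurable_occ.
apply: measurable_seq => x _; apply: measurable_seq => k _.
by apply: measurable_arrow_count => //; apply: measurable_nonzero.
Qed.

(** Markov's inequality, summed over the finitely many atoms. *)
Lemma small_markov (f : conf -> seq (option I) -> R) (c : R) :
  (forall e (s : seq (option I)), 0 <= f e s) -> 0 < c ->
  small P [set w | c <= f (ring_conf w) (ring_word w)]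
    (Ebern rho (fun e => Ew (bern_prod (hit_rate lam)) (@row_site N) n (f e)) / c).
Proof.
move=> f0 c0; have p01 := hit_rate01 (ltW lam0).
pose wt (a : conf * n.-tuple conf) :=
  bern_prod rho a.1 * \prod_(b <- a.2) bern_prod (hit_rate lam) b.
pose Q (a : conf * n.-tuple conf) := c <= f a.1 (map (@row_site N) a.2).
have wt0 a : 0 <= wt a.
  rewrite mulr_ge0 ?bern_prod_ge0 // prodr_ge0 // => b _.
  exact: bern_prod_ge0.
have -> : Ebern rho (fun e => Ew (bern_prod (hit_rate lam)) (@row_site N) n (f e)) =
    \sum_a wt a * f a.1 (map (@row_site N) a.2).
  rewrite /Ebern -(pair_bigA _ (fun e (s : n.-tuple conf) =>
    wt (e, s) * f e (map (@row_site N) s))) /=.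
  apply: eq_bigr => e _; rewrite Ew_tuple mulr_sumr; apply: eq_bigr => s _.
  by rewrite /wt /= mulrA.
apply: (smallS (B := [set w | exists2 a, a \in enum Q & atom a.1 a.2 w])
  (x := \sum_(a <- enum Q) wt a)).
- move=> w cf; have sz : size (ring_rows w) == n by rewrite size_mkseq.
  by exists (ring_conf w, Tuple sz) => //; rewrite mem_enum unfold_in.
- rewrite big_enum_cond /= mulr_suml big_mkcond; apply: ler_sum => a _.
  case: ifP => [Qa|_].
    by rewrite ler_pdivlMr // ler_wpM2l //; case/andP: Qa.
  by apply: divr_ge0; [apply: mulr_ge0|apply: ltW].
- apply: small_seq => a _; have [Pa ma] := P_atom a.1 a.2.
  by apply: small_measurable => //; rewrite Pa.
Qed.

End finite_law.
End input_law.

(** * Almost every set of arrows is regular *)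

Section almost_sure_regularity.
Context {R : realType} {d : measure_display} {T : measurableType d}.
Context {P : probability T R} {omega : T -> set (int * R)}.
Context (omega_poisson : poisson_process P omega).

Lemma exists_natr_gt (x : R) : exists n, forall m, (n <= m)%N -> x < m%:R.
Proof.
exists (Num.truncn `|x|).+1 => m nm; apply: (le_lt_trans (ler_norm _)).
by apply: lt_le_trans (truncnS_gt _ ) _ => //; rewrite ler_nat.
Qed.

Lemma small_bad_slots_ex N M (t e : R) n0 : 0 < t -> 0 < e ->
  exists2 n, (n0 < n)%N & small P [set w | ~ good_slots N M (omega w) (t / n%:R) n] e.
Proof.
move=> t0 e0; set C : R := N.+2%:R + N.+2%:R ^+ 2.
have C0 : 0 < C by rewrite ltr_pwDl ?sqr_ge0 ?ltr0n.
have [m mP] := exists_natr_gt (C * t ^+ 2 / e).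
exists (maxn m n0).+1; first by rewrite ltnS leq_maxr.
set n := (maxn m n0).+1; have n_gt0 : (0 : R) < n%:R by rewrite ltr0n.
have lam0 : 0 < t / n%:R by rewrite divr_gt0.
apply: smallS (small_bad_slots omega_poisson N M n lam0); first by [].
have -> : n%:R * (C * (t / n%:R) ^+ 2) = C * t ^+ 2 / n%:R.
  by field; apply: lt0r_neq0.
rewrite ler_pdivrMr // -ler_pdivrMl // mulrC; apply/ltW/mP.
by rewrite /n ltnW // ltnS leq_maxl.
Qed.

Lemma hit_rate_pow (t e : R) : 0 < t -> 0 < e ->
  exists K, hit_rate t ^+ K <= e.
Proof.
move=> t0 e0; have /andP[h0 h1] := hit_rate01 (ltW t0).
have hlt1 : `|hit_rate t| < 1.
  by rewrite ger0_norm // /hit_rate ltrBlDr ltrDl expR_gt0.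
have /cvgr0Pnorm_le/(_ _ e0)[K _ KP] := cvg_expr hlt1.
exists K; have := KP K (leqnn K); rewrite /= ger0_norm //.
exact: exprn_ge0.
Qed.

(** [K] is independent of the location of the sites, so it can be fixed before the window is. *)
Lemma small_no_quiet_ex (t e : R) : 0 < t -> 0 < e ->
  exists K, forall l : seq int, uniq l -> size l = K ->
    small P [set w | forall x, x \in l -> ~ quiet (omega w) t x] e.
Proof.
move=> t0 e0; have [K Ke] := hit_rate_pow t0 e0; exists K => l l_uniq lK.
by apply: smallS (small_no_quiet omega_poisson t0 l_uniq); rewrite ?lK.
Qed.

Definition irange x (n : nat) : seq int := [seq x + k%:Z | k <- iota 0 n].

Lemma irange_uniq x n : uniq (irange x n).
Proof. by rewrite map_inj_uniq ?iota_uniq // => i j /addrI []. Qed.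

Lemma size_irange x n : size (irange x n) = n.
Proof. by rewrite size_map size_iota. Qed.

Lemma mem_irange x n z : z \in irange x n -> x <= z < x + n%:Z.
Proof. by case/mapP=> k; rewrite mem_iota => /andP[_ kn] ->; lia. Qed.

(** Countably many exceptional events suffice: quietness is monotone in time, and finiteness and
    distinct times pass to smaller boxes and shorter times. *)
Lemma regular_ae : P.-negligible [set w | ~ regular (omega w)].
Proof.
(* The window consists of the sites from [- m.+1] to [m.+1], observed up to time [m.+1] in [n.+1]
   slots. *)
pose bad1 m := [set w | forall n, ~ good_slots m.*2.+1 m.+1 (omega w) (m.+1%:R / n.+1%:R) n.+1].
pose badl (t x : nat) := [set w | forall n : nat,
  forall z, z \in irange (- x%:Z - n%:Z) n -> ~ quiet (omega w) t.+1%:R z].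
pose badr (t x : nat) := [set w | forall n : nat,
  forall z, z \in irange (x%:Z + 1) n -> ~ quiet (omega w) t.+1%:R z].
have N1 m : P.-negligible (bad1 m).
  apply: small_negligible => e e0.
  have [[//|n] _ sn] := small_bad_slots_ex m.*2.+1 m.+1 0 (ltr0Sn R m) e0.
  by apply: smallS sn => // w /(_ n).
have Nl t x : P.-negligible (badl t x).
  apply: small_negligible => e e0.
  have [K KP] := small_no_quiet_ex (ltr0Sn R t) e0.
  by apply: smallS (KP _ (irange_uniq _ _) (size_irange _ _)) => [w|//]; apply.
have Nr t x : P.-negligible (badr t x).
  apply: small_negligible => e e0.
  have [K KP] := small_no_quiet_ex (ltr0Sn R t) e0.
  by apply: smallS (KP _ (irange_uniq _ _) (size_irange _ _)) => [w|//]; apply.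
apply: (@negligibleS _ _ _ _ ((\bigcup_m bad1 m) `|`
  ((\bigcup_t \bigcup_x badl t x) `|` (\bigcup_t \bigcup_x badr t x)))); last first.
  apply: negligibleU; first exact: negligible_bigcup.
  by apply: negligibleU; apply: negligible_bigcup => t; apply: negligible_bigcup.
move=> w; apply: contra_notP => /not_orP[g1 /not_orP[gl gr]].
have quietS (s t : R) x : s <= t -> quiet (omega w) t x -> quiet (omega w) s x.
  by move=> st q u /andP[u0 us]; apply: q; rewrite u0 (le_trans us).
have slots (t : R) (b : int * int) : exists N M lam n, [/\ 0 <= lam,
    good_slots N M (omega w) lam n, t <= n%:R * lam,
    (window N M).1 <= b.1 & b.2 <= (window N M).2].
  pose m := ((Num.truncn `|t|).+1 + `|b.1| + `|b.2|)%N.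
  have [n gn] : exists n, good_slots m.*2.+1 m.+1 (omega w) (m.+1%:R / n.+1%:R) n.+1.
    by apply: contrapT => ng; apply: g1; exists m => // n gn; apply: ng; exists n.
  exists m.*2.+1, m.+1, (m.+1%:R / n.+1%:R), n.+1; split=> //.
  - rewrite mulrC divfK ?pnatr_eq0 //; apply: (le_trans (ler_norm _)).
    apply: (le_trans (ltW (truncnS_gt _))).
    by rewrite ler_nat leqW // /m -addnA leq_addr.
  - by rewrite /window /m /=; lia.
  - by rewrite /window /m /=; lia.
have tT (t : R) : t <= (Num.truncn `|t|).+1%:R.
  by apply: (le_trans (ler_norm _)); apply: ltW; apply: truncnS_gt.
split=> [t b|t b p q bp bq|t x|t x].
- have [N [M [lam [n [lam0 gn tn b1 b2]]]]] := slots t b.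
  by have [] := good_slots_regular lam0 gn tn b1 b2.
- have [N [M [lam [n [lam0 gn tn b1 b2]]]]] := slots t b.
  by have [_] := good_slots_regular lam0 gn tn b1 b2; apply.
- apply: contrapT => no; apply: gl; exists (Num.truncn `|t|) => //; exists `|x|%N => //.
  move=> n z /mem_irange zn /(quietS _ _ _ (tT t)) qz; apply: no.
  by exists z => //; lia.
- apply: contrapT => no; apply: gr; exists (Num.truncn `|t|) => //; exists `|x|%N => //.
  move=> n z /mem_irange zn /(quietS _ _ _ (tT t)) qz; apply: no.
  by exists z => //; lia.
Qed.

End almost_sure_regularity.

Section ring_windows.
Context {R : realType} (N M : nat).
Local Notation I := 'I_N.+2.

Lemma row_site_prob (p : R) (i : I) :
  \sum_(a | row_site a == Some i) bern_prod p a = p * (1 - p) ^+ N.+1.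
Proof.
rewrite (eq_bigl (pred1 (single i))); last by move=> a; rewrite /= row_site_eq.
rewrite big_pred1_eq /bern_prod (bigD1 i) //= ffunE eqxx; congr (_ * _).
rewrite (eq_bigr (fun=> 1 - p)); last by move=> j /negbTE ji; rewrite ffunE ji.
by rewrite prodr_const cardC1 card_ord.
Qed.

Lemma site_iter (i : I) j : site M i + j%:Z < N.+2%:Z - M%:Z ->
  site M (iter j (@next N) i) = site M i + j%:Z.
Proof.
elim: j => [|j IH] ij /=; first by rewrite addr0.
have sj : site M (iter j (@next N) i) = site M i + j%:Z by apply: IH; lia.
rewrite nextE; case: eqP => [jN|_]; last by rewrite sj; lia.
by move: sj ij; rewrite {1}/site jN; lia.
Qed.

Lemma window_uniq (i : I) L : site M i + L%:Z <= N.+2%:Z - M%:Z ->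
  uniq (traject (@next N) i L).
Proof.
move=> iL; rewrite -(map_inj_uniq (@site_inj N M)).
rewrite (_ : map _ _ = irange (site M i) L); first exact: irange_uniq.
apply: (@eq_from_nth _ 0); rewrite size_map size_traject ?size_irange // => j jL.
rewrite (nth_map i) ?size_traject // nth_traject // site_iter; last by lia.
by rewrite (nth_map 0%N) ?size_iota // nth_iota.
Qed.

Lemma mem_window (i j : I) L : site M i + L%:Z <= N.+2%:Z - M%:Z ->
  (j \in traject (@next N) i L) = (site M i <= site M j < site M i + L%:Z).
Proof.
move=> iL; apply/trajectP/idP => [[k kL ->]|jL].
  by rewrite site_iter; lia.
exists (absz (site M j - site M i)); first by lia.
by apply: (@site_inj N M); rewrite site_iter; lia.
Qed.

End ring_windows.

Section deviation.
Context {R : realType}.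
Implicit Types (t lam : R).

(* The middle term is the probability that, in a slot of length [lam], a given
   site of a ring of [N.+2] sites is the only one with an arrow. *)
Lemma hop_rate_bounds lam N : 0 <= lam ->
  lam * (1 - N.+2%:R * lam) <= hit_rate lam * (1 - hit_rate lam) ^+ N.+1 <= lam.
Proof.
move=> lam0; have /andP[h0 h1] := hit_rate01 lam0; have hl := hit_rate_le lam.
have hE : 1 - hit_rate lam = expR (- lam) by rewrite /hit_rate subKr.
apply/andP; split; last first.
  apply: (le_trans _ hl); rewrite ler_piMr // exprn_ile1 //; lra.
(* This is [1 + lam <= expR lam]. The lower bound then becomes [lam * expR (- (N.+2 * lam))], to
   which the same inequality applies. *)
have e1 : lam * expR (- lam) <= hit_rate lam.
  rewrite /hit_rate lerBrDr -[X in _ + X]mul1r -mulrDl addrC.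
  by rewrite -ler_pdivlMr ?expR_gt0 // expRN invrK mul1r expR_ge1Dx.
apply: (@le_trans _ _ (lam * expR (- lam) * (1 - hit_rate lam) ^+ N.+1)); last first.
  by rewrite ler_wpM2r // exprn_ge0 // hE expR_ge0.
rewrite hE -mulrA -exprS -expRM_natl ler_wpM2l //.
by have := expR_ge1Dx (N.+2%:R * - lam); rewrite mulrN.
Qed.

End deviation.

(** * Deviation of the flux through a fixed bond *)

Section flux_estimate.
Context {R : realType} {d : measure_display} {T : measurableType d}.
Context {P : probability T R}.
Context {U : int -> {RV P >-> R}} {omega : T -> set (int * R)}.
Context (U_unif : iid_uniform U) (omega_poisson : poisson_process P omega).
Context (U_omega : independent_inputs omega U).
Context (rho : R) (rho01 : 0 <= rho <= 1).
Context (N M : nat) (lam : R) (lam0 : 0 < lam) (n : nat).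

Local Notation conf w := (ring_conf (U := U) rho N M w).
Local Notation word w := (ring_word (omega := omega) N M lam n w).
Local Notation q := (hit_rate lam * (1 - hit_rate lam) ^+ N.+1).

(** Chebyshev's inequality for [Ebern_current_sqr], with [q] bounded by [lam] so that only the
    elapsed time [n * lam] remains. *)
Lemma small_current (i : 'I_N.+2) (L : nat) (c : R) : 0 < c ->
  uniq (traject (@next N) i L) ->
  small P [set w | c <= `|\sum_(x <- traject (@next N) i L)
      (current (@next N) (conf w) (word w) x)%:R
      - n%:R * (q * L%:R * (rho * (1 - rho)))|]
    ((2 * (n%:R * lam * L%:R) + 6 * ((n%:R * lam) ^+ 2 * L%:R)) / c ^+ 2).
Proof.
move=> c0 l_uniq; have p01 := hit_rate01 (ltW lam0).
have /andP[q_lo q_hi] := hop_rate_bounds N (ltW lam0).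
have q0 : 0 <= q by rewrite mulr_ge0 ?exprn_ge0 //; case/andP: p01; lra.
pose f e (s : seq (option 'I_N.+2)) : R := (\sum_(x <- traject (@next N) i L)
      (current (@next N) e s x)%:R - n%:R * (q * L%:R * (rho * (1 - rho)))) ^+ 2.
apply: smallS (small_markov U_unif omega_poisson U_omega rho01 M lam0 n (f := f)
  (fun e s => sqr_ge0 _) (exprn_gt0 2 c0)) => [w /= cw|].
  by rewrite /f -[leRHS]real_normK ?num_real // ler_sqr ?nnegrE // ltW.
rewrite ler_wpM2r ?invr_ge0 ?sqr_ge0 //.
have := Ebern_current_sqr rho01 (@next_inj N) (@next_neq N)
  (fun a => bern_prod_ge0 p01 a) (bern_prod_sum1 _) (row_site_prob (hit_rate lam)) l_uniq n.
rewrite size_traject => /le_trans -> //.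
apply: lerD; first by rewrite ler_wpM2l // -mulrA ler_wpM2l // ler_wpM2r.
rewrite natrM.
have -> : 2 * (n%:R ^+ 2 * (q ^+ 2 * (3 * L%:R))) = 6 * ((n%:R * q) ^+ 2 * L%:R) by ring.
have nq : 0 <= n%:R * q <= n%:R * lam by rewrite mulr_ge0 //= ler_wpM2l.
by rewrite ler_wpM2l // ler_wpM2r //; nra.
Qed.

Lemma small_particles (i : 'I_N.+2) (m : nat) (c : R) : 0 < c ->
  uniq (traject (@next N) i m) ->
  small P [set w | c <= `|\sum_(x <- traject (@next N) i m) (conf w x)%:R - m%:R * rho|]
    (m%:R / c ^+ 2).
Proof.
move=> c0 l_uniq; have p01 := hit_rate01 (ltW lam0).
pose f (e : {ffun 'I_N.+2 -> bool}) (s : seq (option 'I_N.+2)) : R :=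
  (\sum_(x <- traject (@next N) i m) (e x)%:R - m%:R * rho) ^+ 2.
apply: smallS (small_markov U_unif omega_poisson U_omega rho01 M lam0 n (f := f)
  (fun e s => sqr_ge0 _) (exprn_gt0 2 c0)) => [w /= cw|].
  by rewrite /f -[leRHS]real_normK ?num_real // ler_sqr ?nnegrE // ltW.
rewrite ler_wpM2r ?invr_ge0 ?sqr_ge0 //.
rewrite (eq_Ebern _ (g := fun e => (\sum_(x <- traject (@next N) i m) (e x)%:R
   - (size (traject (@next N) i m))%:R * rho) ^+ 2)); last first.
  by move=> e; rewrite (eq_Ew _ _ (g := fun=> f e [::])) // Ew_cst ?bern_prod_sum1 // size_traject.
by have := Ebern_particles rho01 l_uniq; rewrite size_traject.
Qed.

End flux_estimate.

(** The signed factor is nonzero exactly on the [|y|] sites between 0 and [y], which form an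
    interval starting at [Num.min 0 y + 1]. *)
Lemma signed_count (R : realType) (N M : nat) (F : 'I_N.+2 -> R) (y : int)
    (i1 : 'I_N.+2) (m : nat) :
  `|y|%N = m -> site M i1 = Num.min 0 y + 1 -> site M i1 + m%:Z <= N.+2%:Z - M%:Z ->
  \sum_i F i * ((y < site M i)%R%:R - (0 < site M i)%R%:R) =
  (if 0 <= y then -1 else 1) * \sum_(x <- traject (@next N) i1 m) F x.
Proof.
move=> ym i1E i1N; rewrite [in RHS]big_uniq ?(window_uniq i1N) //= mulr_sumr [RHS]big_mkcond /=.
apply: eq_bigr => i _; rewrite (mem_window _ i1N) i1E.
case: (leP 0 y) => y0.
  have -> : (0 + 1 <= site M i < 0 + 1 + m%:Z) = (0 < site M i) && ~~ (y < site M i).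
    by lia.
  have ys0 : y < site M i -> 0 < site M i by lia.
  move: ys0; case: (y < site M i); case: (0 < site M i) => /= h;
    first [by have := h isT | by ring].
have -> : (y + 1 <= site M i < y + 1 + m%:Z) = (y < site M i) && ~~ (0 < site M i).
  by lia.
have ys0 : 0 < site M i -> y < site M i by lia.
move: ys0; case: (y < site M i); case: (0 < site M i) => /= h;
  first [by have := h isT | by ring].
Qed.

Lemma combine_deviations (R : realType) (J S t r k a L E : R) (b : bool) :
  `|J - t * k| <= L + 2 * E -> `|S - a * r| < E ->
  `|J + (if b then -1 else 1) * S - (k * t - r * ((if b then 1 else -1) * a))| <= L + 3 * E.
Proof.
rewrite !ler_norml !ltr_norml => /andP[? ?] /andP[? ?].
by case: b => /=; apply/andP; split; lra.
Qed.

Section flux_deviation.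
Context {R : realType} {d : measure_display} {T : measurableType d}.
Context {P : probability T R}.
Context {U : int -> {RV P >-> R}} {omega : T -> set (int * R)}.
Context (U_unif : iid_uniform U) (omega_poisson : poisson_process P omega).
Context (U_omega : independent_inputs omega U).
Context (rho : R) (rho01 : 0 <= rho <= 1).

(** The centre is the stationary current through a bond minus the mean signed number of particles
    initially between 0 and [y]. The witness [g] makes finiteness of the flux part of the event. *)
Definition flux_close (y : int) (t c : R) : set T :=
  [set w | exists2 g : R,
     flux (omega w) (bernoulli_config U rho w) (fun=> y%:~R) t = g%:E &
     `|g - (rho * (1 - rho) * t - rho * y%:~R)| <= c].

(** In the deviation, [L] comes from comparing the bond at [y] with its [L] neighbours, and one
    [eps * t] each from the averaged current, from replacing [n * q] by [t] and from the particle
    count. In the probability, one [eta] each pays for bad slots and for the lack of a quiet site on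
    either side. *)
Lemma small_flux_deviation (t : R) (y : int) (L : nat) (eps eta : R) :
  0 < t -> 0 < eps -> 0 < eta -> (0 < L)%N ->
  small P [set w | regular (omega w) /\ ~ flux_close y t (L%:R + 3 * (eps * t)) w]
    ((2 / t + 6) / (L%:R * eps ^+ 2) + `|y|%N%:R / (eps * t) ^+ 2 + 3 * eta).
Proof.
move=> t0 eps0 eta0 L0; have et0 : 0 < eps * t by rewrite mulr_gt0.
have LR : (0 : R) < L%:R by rewrite ltr0n.
have [K KP] := small_no_quiet_ex omega_poisson t0 eta0.
have [a aE] : exists a : nat, `|y|%N = a by exists `|y|%N.
have yE : y%:~R = (if 0 <= y then 1 else -1) * a%:R :> R.
  case: (leP 0 y) => y0.
    have ya : y = a%:Z by lia.
    by rewrite ya mul1r -pmulrn.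
  have ya : y = - a%:Z by lia.
  by rewrite ya mulrNz mulN1r -pmulrn.
(* Quiet sites are sought among the [K] sites from [- M] on and the [K] sites from [a + 1] on, to
   the left and to the right of both 0 and [y]. The further [L] sites keep the averaging bonds from
   wrapping around. *)
have [M ME] : exists M : nat, M%:Z = K%:Z + a%:Z + 1 by exists (K + a + 1)%N; lia.
have [N NE] : exists N : nat, N.+2%:Z - M%:Z = a%:Z + K%:Z + L%:Z + 2.
  by exists (M + a + K + L)%N; lia.
have y_lo : - a%:Z <= y by lia.
have y_hi : y <= a%:Z by lia.
have boxP (b1 b2 : int) : - M%:Z <= b1 < - M%:Z + K%:Z -> a%:Z + 1 <= b2 < a%:Z + 1 + K%:Z ->
    [/\ - M%:Z <= b1, b2 < N.+2%:Z - M%:Z, b1 < 0 <= b2 & b1 < y < b2].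
  by rewrite NE => b1P b2P; split; lia.
(* More than [n0] slots give [N.+2 * lam <= eps], which puts [n * q] within [eps * t] of [t]. *)
have [n0 n0P] := exists_natr_gt (N.+2%:R * t / eps).
have [n n0n bad_slots] := small_bad_slots_ex omega_poisson N M n0 t0 eta0.
have nR : (0 : R) < n%:R by rewrite ltr0n (leq_ltn_trans _ n0n).
set lam := t / n%:R in bad_slots.
have lam0 : 0 < lam by rewrite divr_gt0.
have nlam : n%:R * lam = t by rewrite /lam mulrC divfK // lt0r_neq0.
have [i0 i0E] : exists i : 'I_N.+2, site M i = y.
  by apply: site_onto; rewrite NE; lia.
have [i1 i1E] : exists i : 'I_N.+2, site M i = Num.min 0 y + 1.
  by apply: site_onto; rewrite NE; lia.
have i0L : site M i0 + L%:Z <= N.+2%:Z - M%:Z by rewrite i0E NE; lia.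
have i1a : site M i1 + a%:Z <= N.+2%:Z - M%:Z.
  by rewrite i1E NE; lia.
have Lc : 0 < L%:R * (eps * t) by rewrite mulr_gt0.
have D1 := small_current U_unif omega_poisson U_omega rho01 M lam0 n Lc (window_uniq i0L).
have D2 := small_particles U_unif omega_poisson U_omega rho01 M lam0 n et0 (window_uniq i1a).
have Q1 := KP _ (irange_uniq (- M%:Z) K) (size_irange _ _).
have Q2 := KP _ (irange_uniq (a%:Z + 1) K) (size_irange _ _).
rewrite nlam in D1; rewrite aE.
apply: (smallS _ _ (smallU (smallU D1 D2) (smallU bad_slots (smallU Q1 Q2)))); last first.
  rewrite lerD // ?lerD //; last by lra.
  rewrite le_eqVlt; apply/orP; left; apply/eqP.
  by field; rewrite !lt0r_neq0.
move=> w [regw]; apply: contra_notP => /not_orP[/not_orP[/= d1 d2]].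
move=> /not_orP[/contrapT good /not_orP[q1 q2]].
have [b1 b1in qb1] : exists2 x, x \in irange (- M%:Z) K & quiet (omega w) t x.
  by apply: contrapT => no; apply: q1 => x xl qx; apply: no; exists x.
have [b2 b2in qb2] : exists2 x, x \in irange (a%:Z + 1) K & quiet (omega w) t x.
  by apply: contrapT => no; apply: q2 => x xl qx; apply: no; exists x.
move: b1in b2in => /mem_irange b1in /mem_irange b2in.
have arrE := arrows_word regw (ltW lam0) good; rewrite nlam in arrE.
have fluxE := flux_ring (b := (b1, b2)) (i0 := i0) (bernoulli_config U rho w) regw qb1 qb2
  _ _ _ _ arrE.
set e := ring_conf (U := U) rho N M w in d1 d2.
set s := ring_word (omega := omega) N M lam n w in d1.
have {fluxE} fluxE : flux (omega w) (bernoulli_config U rho w) (fun=> y%:~R) t =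
    ((current (@next N) e s i0)%:R +
     \sum_i (e i)%:R * ((y < site M i)%R%:R - (0 < site M i)%R%:R))%:E.
  by have [p1 p2 p3 p4] := boxP _ _ b1in b2in; move: fluxE; rewrite i0E; apply.
eexists; first exact: fluxE.
rewrite (signed_count _ aE i1E i1a).
set C := \sum_(x <- traject _ i0 L) _ in d1.
set S := \sum_(x <- traject _ i1 a) _ in d2 *.
move: d1 d2 => /negP; rewrite -ltNge => d1 /negP; rewrite -ltNge => d2.
set J : R := (current _ e s i0)%:R.
have CJ : `|C - L%:R * J| <= L%:R * L%:R.
  rewrite /C /J.
  have -> : L%:R * (current (@next N) e s i0)%:R =
      \sum_(x <- traject (@next N) i0 L) (current (@next N) e s i0)%:R :> R.
    by rewrite big_const_seq count_predT size_traject iter_addr_0 mulr_natl.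
  rewrite -sumrB (le_trans (ler_norm_sum _ _ _)) //.
  rewrite -[leRHS]/(_ * _) [leRHS](_ : _ = \sum_(x <- traject (@next N) i0 L) (L%:R : R)).
    rewrite big_seq [leRHS]big_seq; apply: ler_sum => x /trajectP[j jL ->].
    have [h1 h2] := current_iter (@next_inj N) (@next_neq N) e s i0 j.
    have jR : j%:R <= L%:R :> R by rewrite ler_nat ltnW.
    move: h1 h2; rewrite -!(ler_nat R) !natrD => h1 h2.
    by rewrite ler_norml; apply/andP; split; lra.
  by rewrite big_const_seq count_predT size_traject iter_addr_0 mulr_natl.
set q := hit_rate lam * _ in d1.
have /andP[q_lo q_hi] := hop_rate_bounds N (ltW lam0).
rewrite -/q in q_lo q_hi.
have Nlam : N.+2%:R * lam <= eps.
  rewrite /lam mulrA ler_pdivrMr // mulrC -[leRHS]mulrC -ler_pdivrMr // mulrC.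
  by apply/ltW/n0P/ltnW.
have nq : t - eps * t <= n%:R * q <= t.
  apply/andP; split; last by rewrite -nlam ler_wpM2l.
  apply: (@le_trans _ _ (n%:R * (lam * (1 - N.+2%:R * lam)))); last by rewrite ler_wpM2l.
  by rewrite mulrA nlam; nra.
have r01 : 0 <= rho * (1 - rho) <= 1 by case/andP: rho01 => r0 r1; apply/andP; split; nra.
have Jq : `|J - n%:R * q * (rho * (1 - rho))| <= L%:R + eps * t.
  rewrite -(ler_pM2l LR) -{1}(gtr0_norm LR) -normrM.
  have -> : L%:R * (J - n%:R * q * (rho * (1 - rho))) =
      (C - n%:R * (q * L%:R * (rho * (1 - rho)))) - (C - L%:R * J) by ring.
  by rewrite (le_trans (ler_normB _ _)) // [leRHS]mulrDr [leRHS]addrC lerD // ltW.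
have nqt : 0 <= (t - n%:R * q) * (rho * (1 - rho)) <= eps * t.
  by case/andP: nq => ? ?; case/andP: r01 => ? ?; apply/andP; split; nra.
have Jt : `|J - t * (rho * (1 - rho))| <= L%:R + 2 * (eps * t).
  by move: Jq; rewrite !ler_norml => /andP[? ?]; apply/andP; split; lra.
by rewrite yE; apply: combine_deviations.
Qed.

End flux_deviation.

(** * Almost sure convergence of the flux *)

Section conclusion.
Context {R : realType} {d : measure_display} {T : measurableType d}.
Context {P : probability T R}.
Context {U : int -> {RV P >-> R}} {omega : T -> set (int * R)}.
Context (U_unif : iid_uniform U) (omega_poisson : poisson_process P omega).
Context (U_omega : independent_inputs omega U).
Context (rho : R) (rho01 : 0 <= rho <= 1).

Local Notation flux_close := (flux_close (U := U) (omega := omega) rho).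

(** The partial sums telescope through [1 / k^2 <= 2 (1 / k - 1 / (k + 1))]. *)
Lemma inv_sqr_summable (D : R) : 0 <= D ->
  (\sum_(k <oo) (D / k.+1%:R ^+ 2)%:E < +oo)%E.
Proof.
move=> D0; apply: (@le_lt_trans _ _ (2 * D)%:E); last exact: ltry.
apply: lime_le.
  by apply: is_cvg_nneseries => k _ _; rewrite lee_fin divr_ge0 ?sqr_ge0.
apply: nearW => n; rewrite sumEFin lee_fin.
apply: (@le_trans _ _ (2 * D * (1 - n.+1%:R^-1))); last first.
  by rewrite ler_piMr ?mulr_ge0 // gerBl invr_ge0.
elim: n => [|n IH]; first by rewrite big_geq // invr1 subrr mulr0.
rewrite big_nat_recr //= -lerBrDr (le_trans IH) //.
have a0 : (0 : R) < n.+1%:R by [].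
have a_ge1 : (1 : R) <= n.+1%:R by rewrite ler1n.
have -> : n.+2%:R = n.+1%:R + 1 :> R by rewrite natr1.
move: (n.+1%:R : R) a0 a_ge1 => a a0 a_ge1.
have a1 : 0 < a + 1 by rewrite addr_gt0.
have -> : 2 * D * (1 - (a + 1)^-1) =
    2 * D * (1 - a^-1) + D / a ^+ 2 + D * (a - 1) / (a ^+ 2 * (a + 1)).
  by field; rewrite !lt0r_neq0.
rewrite addrAC addrK lerDl; apply: divr_ge0.
  by rewrite mulr_ge0 // subr_ge0.
by rewrite mulr_ge0 ?sqr_ge0 // ltW.
Qed.

Definition cube (k : nat) : R := k.+1%:R ^+ 3.

(** With [eta = 1 / k^2] as well, every term of [small_flux_deviation] is of order [1 / k^2], even
    for [y k] as large as a multiple of the time, and Borel-Cantelli applies. *)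
Lemma flux_close_cubes (y : nat -> int) (C : nat) :
  (forall k, (`|y k| <= C * k.+1 ^ 3)%N) ->
  P.-negligible [set w | ~ forall m, exists n, forall k, (n <= k)%N ->
     flux_close (y k) (cube k) (cube k / m.+1%:R) w].
Proof.
move=> yC.
(* With this value [3 * eps * t] is half of the allowed [t / m.+1]; the other half absorbs [L] as
   soon as [k.+1] reaches [2 * m.+1]. *)
pose eps (m : nat) : R := (6 * m.+1%:R)^-1.
pose bad m k := [set w | regular (omega w) /\
  ~ flux_close (y k) (cube k) ((k.+1 ^ 2)%:R + 3 * (eps m * cube k)) w].
have eps0 m : 0 < eps m by rewrite invr_gt0 mulr_gt0.
pose D m : R := (8 + C%:R) / eps m ^+ 2 + 3.
have D0 m : 0 <= D m by rewrite addr_ge0 // divr_ge0 ?addr_ge0 ?sqr_ge0.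
have small_bad m k : small P (bad m k) (D m / k.+1%:R ^+ 2).
  have a1 : 1 <= k.+1%:R :> R by rewrite ler1n.
  have t0 : 0 < cube k by rewrite exprn_gt0.
  have eta0 : 0 < ((k.+1%:R : R) ^+ 2)^-1 by rewrite invr_gt0 exprn_gt0.
  have L0 : (0 < k.+1 ^ 2)%N by rewrite expn_gt0.
  apply: smallS (small_flux_deviation U_unif omega_poisson U_omega rho01
    (y k) t0 (eps0 m) eta0 L0) => //.
  have yk : `|y k|%N%:R <= C%:R * cube k.
    by rewrite /cube -natrX -natrM ler_nat.
  move: a1 yk; rewrite /D /cube natrX; move: (k.+1%:R : R) => a a1 yk.
  have a0 : 0 < a by lra.
  have a3 : 1 <= a ^+ 3 by rewrite exprn_ege1.
  have e0 := eps0 m.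
  have b1 : (2 / a ^+ 3 + 6) / (a ^+ 2 * eps m ^+ 2) <= 8 / eps m ^+ 2 / a ^+ 2.
    have -> : 8 / eps m ^+ 2 / a ^+ 2 = 8 / (a ^+ 2 * eps m ^+ 2).
      by field; rewrite !lt0r_neq0.
    have ae : 0 <= (a ^+ 2 * eps m ^+ 2)^-1.
      by rewrite invr_ge0; apply: mulr_ge0; apply: sqr_ge0.
    rewrite ler_wpM2r //.
    have : 2 / a ^+ 3 <= 2 by rewrite ler_piMr // invf_le1 // (lt_le_trans ltr01).
    lra.
  have b2 : `|y k|%N%:R / (eps m * a ^+ 3) ^+ 2 <= C%:R / eps m ^+ 2 / a ^+ 2.
    apply: (@le_trans _ _ (C%:R * a ^+ 3 / (eps m * a ^+ 3) ^+ 2)).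
      by rewrite ler_wpM2r // invr_ge0 sqr_ge0.
    have -> : C%:R * a ^+ 3 / (eps m * a ^+ 3) ^+ 2 = C%:R / eps m ^+ 2 / a ^+ 2 * a^-1.
      by field; rewrite !lt0r_neq0.
    rewrite ler_piMr ?invf_le1 //; apply: divr_ge0; last exact: sqr_ge0.
    by apply: divr_ge0; last exact: sqr_ge0.
  have -> : ((8 + C%:R) / eps m ^+ 2 + 3) / a ^+ 2 =
      8 / eps m ^+ 2 / a ^+ 2 + C%:R / eps m ^+ 2 / a ^+ 2 + 3 * (a ^+ 2)^-1.
    by field; rewrite !lt0r_neq0.
  by rewrite lerD // lerD.
apply: (@negligibleS _ _ _ _ ([set w | ~ regular (omega w)] `|`
  \bigcup_m [set w | forall n, exists2 k, (n <= k)%N & bad m k w])); last first.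
  apply: negligibleU; first exact: regular_ae omega_poisson.
  apply: negligible_bigcup => m.
  exact: small_borel_cantelli (small_bad m) (inv_sqr_summable (D0 m)).
move=> w; apply: contra_notP => /not_orP[/contrapT regw good] m.
have [n nP] : exists n, forall k, (n <= k)%N -> ~ bad m k w.
  apply: contrapT => no; apply: good; exists m => // n.
  apply: contrapT => nobad; apply: no; exists n => k nk badk.
  by apply: nobad; exists k.
exists (maxn n (2 * m.+1)) => k; rewrite geq_max => /andP[nk mk].
have [g gE gle] : flux_close (y k) (cube k) ((k.+1 ^ 2)%:R + 3 * (eps m * cube k)) w.
  by apply: contrapT => nc; apply: (nP _ nk).
exists g => //; apply: (le_trans gle).
have mk' : 2 * m.+1%:R <= k.+1%:R :> R by rewrite -natrM ler_nat ltnW.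
rewrite /eps /cube natrX; move: (k.+1%:R : R) mk' => a mk'.
have m0 : 0 < m.+1%:R :> R by [].
have -> : a ^+ 2 + 3 * ((6 * m.+1%:R)^-1 * a ^+ 3) =
    a ^+ 2 * (2 * m.+1%:R) / (2 * m.+1%:R) + a ^+ 3 / (2 * m.+1%:R).
  by field; rewrite lt0r_neq0.
have -> : a ^+ 3 / m.+1%:R = a ^+ 3 / (2 * m.+1%:R) + a ^+ 3 / (2 * m.+1%:R).
  by field; rewrite lt0r_neq0.
rewrite lerD // ler_wpM2r ?invr_ge0 ?mulr_ge0 //.
by rewrite [leRHS]exprSr ler_wpM2l // sqr_ge0.
Qed.

Lemma cube_step k : cube k.+1 - cube k <= 7 * k.+1%:R ^+ 2 /\ cube k <= cube k.+1.
Proof.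
have a1 : 1 <= k.+1%:R :> R by rewrite ler1n.
rewrite /cube -[k.+2%:R]natr1; move: (k.+1%:R : R) a1 => a a1.
by split; nra.
Qed.

(** Lets [slack k] also cover the time interval that ends at [cube k], as [below] requires. *)
Lemma cube_convex k : cube k.+1 - cube k <= cube k.+2 - cube k.+1.
Proof.
have a0 : 0 <= k.+1%:R :> R by [].
rewrite /cube -[k.+3%:R]natr1 -[k.+2%:R]natr1; move: (k.+1%:R : R) a0 => a a0.
by nra.
Qed.

Lemma cube_between (t : R) (J : nat) : cube J <= t ->
  exists2 j, (J <= j)%N & cube j <= t <= cube j.+1.
Proof.
move=> Jt; have ex : exists j, t < cube j.+1.
  have [n nP] := exists_natr_gt t.
  exists n; apply: (lt_le_trans (nP n.+2 _)); first by rewrite ltnW // ltnW.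
  by rewrite /cube ler_eXnr // ler1n.
have cube_le i j : (i <= j)%N -> cube i <= cube j.
  by move=> ij; rewrite /cube lerXn2r ?nnegrE // ler_nat.
case: (ex_minnP ex) => j tj jmin; exists j.
  by rewrite leqNgt; apply/negP => jJ; move: tj; rewrite ltNge (le_trans (cube_le _ _ jJ)).
rewrite (ltW tj) andbT; case: j tj jmin => [|j] tj jmin.
  exact: le_trans (cube_le 0%N J _) Jt.
by rewrite leNgt; apply/negP => /jmin; rewrite ltnn.
Qed.

End conclusion.

(** * Interpolation between consecutive cubes *)

Section sandwich.
Context {R : realType}.
Implicit Types (rho a c e x s t y g : R).

(** Half of the error [e] is spent on the deviation of [g], half on the time gap, the shift of the
    barrier and rounding, all of order [x^2] against [s = x^3]. Since [7 c x^2] bounds the shift at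
    index [x] and [7 c (x + 1)^2 <= 28 c x^2] at the next one, the constant 28 serves both
    barriers. *)
Lemma lower_barrier rho a c e x s t y g : 0 <= rho <= 1 -> 0 <= c -> 1 <= x ->
  0 <= e -> 0 <= s <= t -> t - s <= 7 * x ^+ 2 ->
  (7 * `|rho * ((1 - rho) - a)| + 28 * c + 1) * x ^+ 2 <= e / 2 * s ->
  y <= a * s + 28 * c * x ^+ 2 + 1 ->
  `|g - (rho * (1 - rho) * s - rho * y)| <= e / 2 * s ->
  rho * ((1 - rho) - a) * t - e * t <= g.
Proof.
move=> /andP[r0 r1] c0 x1 e0 /andP[s0 st] ts Bx yU; rewrite ler_norml => /andP[gL _].
set l := rho * ((1 - rho) - a) in Bx *.
have x2 : 1 <= x ^+ 2 by rewrite exprn_ege1.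
have lts : l * (t - s) <= `|l| * (7 * x ^+ 2).
  by apply: (le_trans (ler_wpM2r _ (ler_norm l))); rewrite ?subr_ge0 // ler_wpM2l.
have K0 : 0 <= 28 * c * x ^+ 2 by rewrite mulr_ge0 ?mulr_ge0 // (le_trans ler01).
have ry : rho * y <= rho * a * s + (28 * c * x ^+ 2 + 1).
  apply: (le_trans (ler_wpM2l r0 yU)); rewrite -addrA mulrDr mulrA lerD2l.
  by rewrite ler_piMl // addr_ge0.
have est : e * s <= e * t by rewrite ler_wpM2l.
have ls : l * s = rho * (1 - rho) * s - rho * a * s by rewrite /l; ring.
lra.
Qed.

Lemma upper_barrier rho a c e x s s' t y g : 0 <= rho <= 1 -> 0 <= c -> 1 <= x ->
  0 <= e -> s <= t <= s' -> s' - t <= 7 * x ^+ 2 ->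
  (7 * `|rho * ((1 - rho) - a)| + 28 * c + 1) * x ^+ 2 <= e / 2 * s ->
  a * s' - 28 * c * x ^+ 2 - 1 <= y ->
  `|g - (rho * (1 - rho) * s' - rho * y)| <= e / 2 * s ->
  g <= rho * ((1 - rho) - a) * t + e * t.
Proof.
move=> /andP[r0 r1] c0 x1 e0 /andP[st ts'] ts Bx yL; rewrite ler_norml => /andP[_ gU].
set l := rho * ((1 - rho) - a) in Bx *.
have x2 : 1 <= x ^+ 2 by rewrite exprn_ege1.
have lts : l * (s' - t) <= `|l| * (7 * x ^+ 2).
  by apply: (le_trans (ler_wpM2r _ (ler_norm l))); rewrite ?subr_ge0 // ler_wpM2l.
have K0 : 0 <= 28 * c * x ^+ 2 by rewrite mulr_ge0 ?mulr_ge0 // (le_trans ler01).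
have ry : rho * a * s' - (28 * c * x ^+ 2 + 1) <= rho * y.
  apply: (le_trans _ (ler_wpM2l r0 yL)).
  rewrite (_ : _ - _ - 1 = a * s' - (28 * c * x ^+ 2 + 1)); last by ring.
  rewrite [leRHS]mulrBr [X in _ <= X - _]mulrA.
  rewrite lerD2l lerN2.
  by rewrite ler_piMl // addr_ge0.
have est : e * s <= e * t by rewrite ler_wpM2l.
have ls : l * s' = rho * (1 - rho) * s' - rho * a * s' by rewrite /l; ring.
lra.
Qed.

End sandwich.

Section barriers.
Context {R : realType} (a : R).

Definition speed : nat := (Num.truncn `|a|).+1.

(** Bounds the displacement of the barrier [a * t] between [cube k] and [cube k.+1]; an integer, as
    the estimates concern the flux through integer sites. *)
Definition slack (k : nat) : nat := (speed * (k.+2 ^ 3 - k.+1 ^ 3))%N.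

(** Not to the left of [a * t] for any [t] between [cube k] and [cube k.+1], so its flux at time
    [cube k] is a lower bound throughout that interval. *)
Definition above (k : nat) : int := Num.floor (a * cube k) + (slack k)%:Z + 1.

(** Used at the end of a time interval: its flux at time [cube k] is an upper bound for the times
    since the previous cube. *)
Definition below (k : nat) : int := Num.floor (a * cube k) - (slack k)%:Z.

Lemma slackE k : (slack k)%:R = speed%:R * (cube k.+1 - cube k) :> R.
Proof.
rewrite natrM natrB ?natrX //; last by rewrite leq_exp2r.
Qed.

Lemma norm_le_speed : `|a| <= speed%:R.
Proof. by apply: ltW; apply: truncnS_gt. Qed.

Lemma above_bounds k :
  a * cube k + (slack k)%:R <= (above k)%:~R <= a * cube k + (slack k)%:R + 1.
Proof.
have /andP[f1 f2] := floor_itv (a * cube k).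
by move: f2; rewrite /above !intrD -!pmulrn => f2; apply/andP; split; lra.
Qed.

Lemma below_bounds k :
  a * cube k - (slack k)%:R - 1 <= (below k)%:~R <= a * cube k - (slack k)%:R.
Proof.
have /andP[f1 f2] := floor_itv (a * cube k).
by move: f2; rewrite /below !intrD intrN -!pmulrn => f2; apply/andP; split; lra.
Qed.

Lemma slack_le k : (slack k)%:R <= 7 * speed%:R * k.+1%:R ^+ 2 :> R.
Proof.
have [h _] := @cube_step R k.
rewrite slackE; apply: (le_trans (ler_wpM2l (ler0n _ speed) h)).
by rewrite mulrA [_ * 7]mulrC.
Qed.

(** One [speed] comes from [a * cube k], seven from [slack_le], and the 1 from rounding. *)
Lemma barrier_size (z : int) k :
  a * cube k - (slack k)%:R - 1 <= z%:~R <= a * cube k + (slack k)%:R + 1 ->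
  (`|z| <= (8 * speed + 1) * k.+1 ^ 3)%N.
Proof.
move=> /andP[z1 z2]; rewrite -(ler_nat R) natrM natrX natrD natrM natr_absz intr_norm.
have sl := slack_le k; have an := norm_le_speed.
have x1 : 1 <= k.+1%:R :> R by rewrite ler1n.
have ac : `|a * cube k| <= speed%:R * k.+1%:R ^+ 3.
  by rewrite normrM [X in _ * X]ger0_norm ?exprn_ge0 // ler_wpM2r // exprn_ge0.
move: (k.+1%:R : R) x1 sl ac => x x1 sl ac.
have x2 : 1 <= x ^+ 2 by rewrite exprn_ege1.
have x23 : x ^+ 2 <= x ^+ 3 by rewrite ler_weXn2l.
have sx : speed%:R * x ^+ 2 <= speed%:R * x ^+ 3 :> R by rewrite ler_wpM2l.
move: ac; rewrite !ler_norml => /andP[ac1 ac2]; apply/andP; split; lra.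
Qed.

End barriers.

Section main.
Context {R : realType} {d : measure_display} {T : measurableType d}.
Context {P : probability T R}.
Context {U : int -> {RV P >-> R}} {omega : T -> set (int * R)}.
Context (rho : R) (rho01 : 0 <= rho <= 1) (a : R).

Local Notation eta w := (bernoulli_config U rho w).

Definition close_eventually (y : nat -> int) : set T :=
  [set w | forall m, exists n, forall k, (n <= k)%N ->
     flux_close (U := U) (omega := omega) rho (y k) (cube k) (cube k / m.+1%:R) w].

Lemma flux_between w (e : R) : regular (omega w) -> close_eventually (above a) w ->
  close_eventually (below a) w -> 0 < e ->
  exists t0 : R, forall t, t0 <= t -> exists2 g : R,
    flux (omega w) (eta w) (fun s : R => (a * s)%R) t = g%:E &
    `|g - rho * ((1 - rho) - a) * t| <= e * t.
Proof.
move=> regw hi lo e0; set l := rho * ((1 - rho) - a).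
(* The deviation at [cube j.+1] has to be at most [e / 2 * cube j], and
   [cube j.+1 <= 8 * cube j]. *)
have [m mP] := exists_natr_gt (16 / e).
have {}mP : 8 / m.+1%:R <= e / 2.
  have := mP m.+1 (leqnSn m); rewrite !ltr_pdivrMr // => me.
  by rewrite ler_pdivrMr // mulrC mulrA ler_pdivlMr //; lra.
have [n1 n1P] := hi m; have [n2 n2P] := lo m.
pose c : R := (speed a)%:R; pose B := 7 * `|l| + 28 * c + 1.
have [J JP] := exists_natr_gt (2 * B / e).
exists (cube (maxn J (maxn n1 n2))) => t /cube_between[j].
rewrite !geq_max => /andP[Jj /andP[n1j n2j]] /andP[st ts'].
have [g1 g1E g1P] := n1P _ n1j; have [g2 g2E g2P] := n2P j.+1 (leqW n2j).
have mi : m.+1%:R^-1 <= e / 2.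
  by apply: le_trans mP; rewrite ler_peMl ?invr_ge0 // ler1n.
have s0 : 0 < cube j :> R by rewrite exprn_gt0.
have t_ge0 : 0 <= t by rewrite (le_trans (ltW s0)).
have up : (g1%:E <= flux (omega w) (eta w) (fun s : R => (a * s)%R) t)%E.
  rewrite -g1E; apply: le_flux => //; first exact: ltW.
  have /andP[aL _] := above_bounds a j; apply: le_trans aL.
  rewrite -lerBlDl -mulrBr (le_trans (ler_norm _)) // normrM slackE.
  rewrite ler_pM // ?norm_le_speed // ger0_norm ?subr_ge0 // lerD2r //.
have down : (flux (omega w) (eta w) (fun s : R => (a * s)%R) t <= g2%:E)%E.
  rewrite -g2E; apply: le_flux => //.
  have /andP[_ bU] := below_bounds a j.+1; apply: (le_trans bU).
  rewrite lerBlDr -lerBlDl -mulrBr (le_trans (ler_norm _)) // normrM slackE.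
  rewrite ler_pM // ?norm_le_speed // ger0_norm ?subr_ge0 //.
  by apply: (le_trans _ (cube_convex j)); rewrite lerD2l lerN2.
(* The flux along the moving barrier is finite because it lies between two finite values. *)
have [g gE] : exists g : R, flux (omega w) (eta w) (fun s : R => (a * s)%R) t = g%:E.
  move: up down; case: (flux _ _ _ _) => [g| |] //=.
  - by exists g.
exists g => //; move: up down; rewrite gE !lee_fin => up down.
have [d1 s12] := @cube_step R j; have [d2 _] := @cube_step R j.+1.
have sl1 := slack_le a j; have sl2 := slack_le a j.+1.
have x1 : 1 <= j.+1%:R :> R by rewrite ler1n.
have Bx : B * j.+1%:R ^+ 2 <= e / 2 * cube j.
  have Bj : B <= e / 2 * j.+1%:R.
    have := JP j.+1 (leqW Jj); rewrite ltr_pdivrMr // => h; lra.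
  by rewrite /cube [in leRHS](exprS _ 2) mulrA ler_wpM2r ?sqr_ge0.
have c0 : 0 <= c by rewrite ler0n.
have s8 : cube j.+1 <= 8 * cube j :> R.
  rewrite /cube -[j.+2%:R]natr1; move: (j.+1%:R : R) x1 => x x1; nra.
rewrite ler_norml; apply/andP; split.
  have : l * t - e * t <= g1.
    apply: (@lower_barrier _ rho a c e j.+1%:R (cube j) t (above a j)%:~R) => //.
    - exact: ltW.
    - by rewrite (ltW s0).
    - by apply: le_trans d1; rewrite lerD2r.
    - have /andP[_ aU] := above_bounds a j; apply: (le_trans aU); rewrite -/c in sl1.
      have := sqr_ge0 (j.+1%:R : R); rewrite lerD2r lerD2l => x2; nra.
    - apply: (le_trans g1P); rewrite mulrC ler_wpM2r ?(ltW s0) //; lra.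
  lra.
have : g2 <= l * t + e * t.
  apply: (@upper_barrier _ rho a c e j.+1%:R (cube j) (cube j.+1) t (below a j.+1)%:~R) => //.
  - exact: ltW.
  - by rewrite st.
  - by apply: le_trans d1; rewrite lerD2l lerN2.
  - have /andP[bL _] := below_bounds a j.+1; apply: (le_trans _ bL); rewrite -/c in sl2.
    have x2 : j.+2%:R ^+ 2 <= 4 * j.+1%:R ^+ 2 :> R.
      by rewrite -[j.+2%:R]natr1; nra.
    have := ler_wpM2l c0 x2; lra.
  - apply: (le_trans g2P); apply: (@le_trans _ _ (8 * cube j / m.+1%:R)).
      by rewrite ler_wpM2r // invr_ge0.
    by rewrite mulrAC ler_wpM2r ?(ltW s0).
lra.
Qed.

Lemma flux_cvg w : regular (omega w) -> close_eventually (above a) w ->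
  close_eventually (below a) w ->
  (flux (omega w) (eta w) (fun s : R => (a * s)%R) t
       * (t^-1)%:E)%E @[t --> +oo] --> (rho * ((1 - rho) - a))%:E.
Proof.
move=> regw hi lo; apply/fine_cvgP; split.
  have [t0 t0P] := flux_between regw hi lo ltr01.
  near=> t; have [|g -> _] := t0P t; last by [].
  by near: t; apply: nbhs_pinfty_ge; apply: num_real.
apply/cvgrPdist_le => e e0; have [t0 t0P] := flux_between regw hi lo e0.
near=> t; have [|g gE ge] := t0P t; first by near: t; apply: nbhs_pinfty_ge; apply: num_real.
have t_gt0 : 0 < t by near: t; apply: nbhs_pinfty_gt; apply: num_real.
rewrite /= gE /= distrC.
have -> : g * t^-1 - rho * ((1 - rho) - a) = (g - rho * ((1 - rho) - a) * t) / t.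
  by field; apply: lt0r_neq0.
by rewrite normrM normfV [X in _ / X]gtr0_norm // ler_pdivrMr.
Unshelve. all: by end_near.
Qed.

End main.

Theorem proposition7p1 (R : realType) (d : measure_display)
  (T : measurableType d) (P : probability T R)
  (U : int -> {RV P >-> R}) (omega : T -> set (int * R))
  (U_unif : iid_uniform U) (omega_poisson : poisson_process P omega)
  (U_omega : independent_inputs omega U)
  (rho : R) (rho01 : 0 <= rho <= 1) (a : R) :
  {ae P, forall w,
    (flux (omega w) (bernoulli_config U rho w) (fun s => (a * s)%R) t
       * (t^-1)%:E)%E @[t --> +oo] --> (rho * ((1 - rho) - a))%:E}.
Proof.
have ae_above : P.-negligible
    (~` close_eventually (U := U) (omega := omega) rho (above a)).
  apply: (flux_close_cubes U_unif omega_poisson U_omega rho01 (C := 8 * speed a + 1)) => k.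
  apply: (barrier_size (a := a)); have := above_bounds a k.
  have := ler0n R (slack a k); lra.
have ae_below : P.-negligible
    (~` close_eventually (U := U) (omega := omega) rho (below a)).
  apply: (flux_close_cubes U_unif omega_poisson U_omega rho01 (C := 8 * speed a + 1)) => k.
  apply: (barrier_size (a := a)); have := below_bounds a k.
  have := ler0n R (slack a k); lra.
apply: (negligibleS _ (negligibleU (regular_ae omega_poisson) (negligibleU ae_above ae_below))).
move=> w; apply: contra_notP => /not_orP[/contrapT regw /not_orP[/contrapT hi /contrapT lo]].
exact: flux_cvg.
Qed.
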